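(* Let $\lambda\in(0,\infty)$ and let $f:\mathbb{R}^d\to[0,\infty)$ be Borel. Then $$\int_{\mathbb{R}^d}Q_\lambda f\,d\gamma_d\;\ge\;\int_{\mathbb{R}}Q_\lambda f^*\,d\gamma\;\ge\;\|f^*\|_{1+\lambda}\;=\;\|f\|_{1+\lambda},$$ where $f^*:\mathbb{R}\to[0,\infty]$ is the Gaussian half-line rearrangement of $f$, and $\|f^*\|_{1+\lambda}=\left(\int_{\mathbb{R}}(f^* )^{1+\lambda}\,d\gamma\right)^{1/(1+\lambda)}$, $\|f\|_{1+\lambda}=\left(\int_{\mathbb{R}^d}f^{1+\lambda}\,d\gamma_d\right)^{1/(1+\lambda)}$.
   Context: $\gamma_d$ is the standard Gaussian measure on $\mathbb{R}^d$, $\gamma=\gamma_1$, and $\Phi(x)=\gamma((-\infty,x))$ with $\Phi^{-1}(0)=-\infty$, $\Phi^{-1}(1)=\infty$. For Borel $A\subseteq\mathbb{R}^d$, $A^*=\{x\in\mathbb{R}:x<\Phi^{-1}(\gamma_d(A))\}$, and $f^*(x)=\int_0^\infty\mathbf{1}_{\{f>r\}^*}(x)\,dr$ for $x\in\mathbb{R}$. For a non-negative Borel function $h$ on $\mathbb{R}^k$ and $\lambda\in(0,\infty)$, $$Q_\lambda h(z)=\sup_{w\in\mathbb{R}^k}h(z+\lambda w)e^{-\lambda|w|^2/2}=\sup_{w\in\mathbb{R}^k}h(z+w)e^{-|w|^2/(2\lambda)}.$$ $Q_\lambda f$ and $Q_\lambda f^*$ are universally measurable; integrals are with respect to completed measures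 and take values in $[0,\infty]$. *)

(* Defs.v *)
From HB Require Import structures.
From mathcomp Require Import all_boot all_order all_algebra.
From mathcomp Require Import all_classical all_reals all_analysis.
From mathcomp Require Import ring lra.

Set Implicit Arguments.
Unset Strict Implicit.
Unset Printing Implicit Defensive.

Import Order.TTheory GRing.Theory Num.Theory.
Import numFieldNormedType.Exports.

Local Open Scope classical_set_scope.
Local Open Scope ring_scope.

Definition borel_rV_display : measure_display.
Proof. exact: default_measure_display. Qed.

Section borel_rV.
Context (R : realType) (d : nat).

Definition borel_rV : set (set 'rV[R]_d) := <<s open >>.

Let borel_rV0 : borel_rV set0.
Proof. exact: sigma_algebra0. Qed.

Let borel_rVC A : borel_rV A -> borel_rV (~` A).
Proof. by move=> bA; rewrite -setTD; exact: sigma_algebraCD. Qed.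

Let borel_rVU (F : (set 'rV[R]_d)^nat) :
  (forall i, borel_rV (F i)) -> borel_rV (\bigcup_i F i).
Proof. exact: sigma_algebra_bigcup. Qed.

HB.instance Definition _ := @isMeasurable.Build borel_rV_display 'rV[R]_d
  borel_rV borel_rV0 borel_rVC borel_rVU.

End borel_rV.

Section gaussian.
Context (R : realType).
Local Notation mR := (measurableTypeR R).

Definition gamma : probability mR R := normal_prob 0 1.

Definition cons_tuple n (p : mR * n.-tuple mR) : n.+1.-tuple mR :=
  [the n.+1.-tuple _ of p.1 :: p.2].

Lemma measurable_cons_tuple n : measurable_fun setT (@cons_tuple n).
Proof. exact: measurable_cons. Qed.

HB.instance Definition _ n :=
  isMeasurableFun.Build _ _ _ _ (@cons_tuple n) (@measurable_cons_tuple n).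

Fixpoint gaussian_tuple n : probability (n.-tuple mR) R :=
  if n is m.+1 then
    distribution (gamma \x gaussian_tuple m)%E (@cons_tuple m)
  else \d_[tuple].

Definition row_tuple n (t : n.-tuple mR) : 'rV[R]_n := \row_i tnth t i.

Lemma open_bigcup_ratbox n (U : set 'rV[R]_n) : open U ->
  exists2 F : nat -> set 'rV[R]_n, U = \bigcup_k F k &
  forall k, exists (a b : 'I_n -> R),
    F k = [set v | forall i, a i < v ord0 i < b i] \/ F k = set0.
Proof.
move=> oU.
pose box (p : 'rV[rat]_n * nat) : set 'rV[R]_n :=
  [set v | forall i, ratr (p.1 ord0 i) - p.2.+1%:R^-1 < v ord0 i
             < ratr (p.1 ord0 i) + p.2.+1%:R^-1].
exists (fun k => if unpickle k is Some p then
           if `[< box p `<=` U >] then box p else set0 else set0); last first.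
  move=> k; case: unpickle => [p|]; last by exists (fun=> 0), (fun=> 0); right.
  case: asboolP => _; last by exists (fun=> 0), (fun=> 0); right.
  exists (fun i => ratr (p.1 ord0 i) - p.2.+1%:R^-1),
    (fun i => ratr (p.1 ord0 i) + p.2.+1%:R^-1); by left.
rewrite eqEsubset; split; last first.
  move=> v [k _]; case: unpickle => [p|//].
  by case: asboolP => // + boxv; exact.
move=> v Uv.
have /nbhs_ballP[e /= e0 veU] : nbhs v U by exact: open_nbhs_nbhs.
have [N Ne] : exists N : nat, N.+1%:R^-1 < e / 2.
  by have := near_infty_natSinv_lt (PosNum (divr_gt0 e0 (ltr0n _ 2))) => -[N _ /(_ N (leqnn N))/= ?]; exists N.
set q : R := N.+1%:R^-1 in Ne.
have q0 : 0 < q by rewrite invr_gt0.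
have /choice[r rP] : forall i : 'I_n, exists r : rat,
    ratr r \in `]v ord0 i - q, v ord0 i + q[.
  move=> i; have /rat_in_itvoo[r rr] : v ord0 i - q < v ord0 i + q.
    by rewrite ltrBlDr -addrA ltrDl addr_gt0.
  by exists r.
pose p : 'rV[rat]_n * nat := (\row_i r i, N).
have boxU : box p `<=` U.
  move=> w wp; apply: veU; split => // i j; rewrite (ord1 i).
  rewrite /ball/= ltr_distlC.
  have := wp j; have := rP j.
  rewrite in_itv/= mxE -/q => /andP[a1 a2] /andP[a3 a4].
  apply/andP; split; lra.
exists (pickle p) => //; rewrite pickleK asboolT// => i /=.
rewrite mxE -/q; have := rP i; rewrite in_itv/= => /andP[a1 a2].
by apply/andP; split; lra.
Qed.

Lemma measurable_row_tuple n : measurable_fun setT (@row_tuple n).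
Proof.
apply: (@measurability _ _ _ _ _ _ (@open 'rV[R]_n)) => //.
move=> _ [U oU <-]; rewrite setTI.
have [F -> FE] := open_bigcup_ratbox oU.
rewrite preimage_bigcup; apply: bigcupT_measurable => k.
have [a [b [->|->]]] := FE k; last by rewrite preimage_set0.
rewrite (_ : _ @^-1` _ =
    \bigcap_i ((@tnth n mR)^~ i @^-1` `]a i, b i[%classic)).
  apply: fin_bigcap_measurable => // i _; rewrite -[X in measurable X]setTI.
  by apply: measurable_tnth => //; exact: measurable_itv.
apply/seteqP; split=> [t tab i _ /=|t tab i].
  by have := tab i; rewrite mxE in_itv.
by have := tab i Logic.I; rewrite mxE /= in_itv.
Qed.

HB.instance Definition _ n :=
  isMeasurableFun.Build _ _ _ _ (@row_tuple n) (@measurable_row_tuple n).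

Definition gaussian n : probability 'rV[R]_n R :=
  distribution (gaussian_tuple n) (@row_tuple n).

Lemma gaussian_box n (A : 'I_n -> set mR) : (forall i, measurable (A i)) ->
  gaussian n [set v | forall i, A i (v ord0 i)] = (\prod_(i < n) gamma (A i))%E.
Proof.
move=> mA.
rewrite [LHS]/= /distribution /pushforward.
rewrite (_ : _ @^-1` _ = [set t | forall i, A i (tnth t i)]); last first.
  by apply/seteqP; split=> t /= tA i; have := tA i; rewrite mxE.
elim: n A mA => [|n IH] A mA.
  by rewrite big_ord0 /= diracE mem_set//= => -[].
rewrite big_ord_recl -IH//= /distribution /pushforward.
rewrite -product_measure1E//; last first.
  rewrite (_ : [set _ | _] = \bigcap_i ((@tnth n mR)^~ i @^-1` A (lift ord0 i))).
    apply: fin_bigcap_measurable => // i _; rewrite -[X in measurable X]setTI.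
    exact: measurable_tnth.
  by apply/seteqP; split=> [t + i _|t + i]; apply.
congr (product_measure1 _ _ _).
apply/seteqP; split=> [[x t] /= xtA|[x t] /= [xA tA] i].
  split; first by have := xtA ord0.
  by move=> i; have := xtA (lift ord0 i); rewrite tnthS.
by case: (unliftP ord0 i) => [j ->|->//]; rewrite tnthS.
Qed.

Definition Phi (x : R) : \bar R := gamma `]-oo, x[%classic.

(* For 0 < p < 1, Phi x = p has exactly one solution x, which xget selects;
   outside [0, 1] the value is irrelevant. *)
Definition Phi_inv (p : \bar R) : \bar R :=
  if p == 0%E then -oo%E
  else if p == 1%E then +oo%E
  else (xget 0 [set x | Phi x = p])%:E.

Definition half_line n (A : set 'rV[R]_n) : set R :=
  [set x | x%:E < Phi_inv (gaussian n A)]%E.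

Definition rearrangement n (f : 'rV[R]_n -> R) (x : R) : \bar R :=
  (\int[lebesgue_measure]_(r in `]0%R, +oo[)
     (\1_(half_line [set y | (r < f y)%R]) x)%:E)%E.

(* The library norm on row vectors is the sup norm. *)
Definition enorm n (w : 'rV[R]_n) : R := Num.sqrt (\sum_i w ord0 i ^+ 2).

Section sup_convolution.
(* Instantiated with (V, N) = ('rV[R]_n, enorm) and (R^o, Num.norm). *)
Context (V : lmodType R) (N : V -> R) (lambda : R).

Definition Qop (h : V -> \bar R) (z : V) : \bar R :=
  ereal_sup [set (h (z + lambda *: w)%R * (expR (- (lambda * N w ^+ 2 / 2)))%:E)%E
            | w in [set: V]].

Lemma QopE (h : V -> \bar R) (z : V) : 0 < lambda ->
  (forall w, N (lambda *: w) = lambda * N w) ->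
  Qop h z = ereal_sup
    [set (h (z + w)%R * (expR (- (N w ^+ 2 / (2 * lambda))))%:E)%E | w in [set: V]].
Proof.
move=> l0 NZ; congr ereal_sup; apply/seteqP; split=> _ [w _ <-] /=.
  exists (lambda *: w) => //; rewrite NZ.
  congr (_ * (expR (- _))%:E)%E.
  by field; rewrite gt_eqF.
have wE : w = lambda *: (lambda^-1 *: w) by rewrite scalerA divff ?scale1r ?gt_eqF.
exists (lambda^-1 *: w) => //; rewrite -wE; congr (_ * (expR (- _))%:E)%E.
by rewrite [in RHS]wE NZ; field; rewrite gt_eqF.
Qed.

End sup_convolution.

Definition Q_rV n (lambda : R) (h : 'rV[R]_n -> \bar R) : 'rV[R]_n -> \bar R :=
  Qop (@enorm n) lambda h.

Definition Q_R (lambda : R) (h : R -> \bar R) : R -> \bar R :=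
  @Qop R^o Num.norm lambda h.

End gaussian.

(* The Caratheodory extension of a finite measure on a sigma-algebra is its
   completion. *)
Section completed.
Context (disp : measure_display) (T : measurableType disp) (R : realType)
  (P : probability T R).

Definition completed_integral (h : T -> \bar R) : \bar R :=
  (\int[@completed_measure_extension _ _ _ P]_x h x)%E.

Definition completed_norm (p : R) (h : T -> \bar R) : \bar R :=
  ('N[@completed_measure_extension _ _ _ P]_(p%:E) [h])%E.

End completed.

(* Main.v *)
(* The upper level sets of [Q_lambda f] are unions of Euclidean enlargements
   {f > s} + B(0, rho), hence open, and the first inequality reduces, level by
   level, to the Gaussian isoperimetric inequality: if [Phi c] is at most the
   measure of A, then [Phi (c + r)] is at most the measure of A + B(0, r).

   Isoperimetry on the line is proved for finite unions of intervals and follows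
   for Borel sets by approximation. In higher dimension it is obtained by Ehrhard
   symmetrization: replacing every section of A in R x R^n by the half-line of the
   same measure reduces the inequality to the plane. In the plane, suppose that
   A + C is contained in A for a cone C; symmetrizing orthogonally to the axis of C
   gives a set stable under a wider cone, whose angle has half the previous defect
   to a half-plane. After a rotation the step can be repeated, so that finitely many
   steps bring A arbitrarily close to a half-plane.

   The second inequality is the Prekopa-Leindler inequality on the line, with
   s = 1 / (1 + lambda), for u = g ^ (1 + lambda) phi, v = phi and w = (Q_lambda g) phi,
   which satisfy u(x)^s v(y)^(1-s) <= w(s x + (1-s) y). The equality of norms holds
   because f and its rearrangement have level sets of the same measure. *)
Require Import Defs.
From mathcomp Require Import all_boot all_order all_algebra.
From mathcomp Require Import all_classical all_reals all_analysis measurable_realfun.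
From mathcomp Require Import ring lra.

Set Implicit Arguments.
Unset Strict Implicit.
Unset Printing Implicit Defensive.

Import Order.TTheory GRing.Theory Num.Theory.
Import numFieldNormedType.Exports.

Local Open Scope classical_set_scope.
Local Open Scope ring_scope.

(** * Affine substitutions and densities *)

(** The plane step also uses isoperimetry in the fibre only, and the fibre is then the line. No
    limit of symmetrized sets is taken, so no compactness enters: a slope k becomes k + sqrt (1 + k
    ^ 2) >= k + 1, the number of steps is fixed by the desired slope, and the remaining error is
    explicit. Such errors, like those of the grid on the line, are absorbed by the continuity of the
    Gaussian distribution function. Level sets are taken with strict inequalities: a supremum then
    exceeds r exactly when some term does, enlargements are open, and the functions met are Borel,
    so that completed integrals reduce to ordinary ones. In the Prekopa-Leindler step one function
    is the Gaussian density, whose level sets are intervals. A bound for the sum of a set and an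
    interval is enough, and a measurable superset stands for the sumset. Dividing both functions by
    their suprema makes their level sets nonempty for the same levels t < 1, as the sumset bound
    requires. *)

Section affine_substitution.
Context (R : realType).
Local Notation mR := (measurableTypeR R).
Local Notation mu := (@lebesgue_measure R).

Lemma measurable_affine (a b : R) :
  measurable_fun [set: mR] (fun x : mR => a * x + b : mR).
Proof. by apply: measurable_funD => //; exact: measurable_funM. Qed.

(** Uniqueness of Lebesgue measure: the scaled image measure agrees with it on half-open intervals.
    For negative [a] the preimage is closed on the other side, with the same length. *)
Lemma lebesgue_measure_affine (a b : R) (A : set mR) : a != 0 -> measurable A ->
  (`|a|%:E * mu ((fun x => a * x + b)%R @^-1` A) = mu A)%E.
Proof.
move=> a0 mA; have an0 : 0 <= `|a| by [].
have := @lebesgue_measure_unique R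
  (mscale (NngNum an0) (pushforward mu (fun x : mR => a * x + b : mR))).
move=> /(_ (measurable_affine a b) _ A mA) /= => -> //.
move=> _ [[c d] _ <-].
rewrite /mscale /= -[pushforward _ _ _]/(mu ((fun x : mR => a * x + b) @^-1` `]c, d])).
have [a_gt0|a_lt0] : 0 < a \/ a < 0 by apply/orP; rewrite orbC -neq_lt.
- rewrite (_ : _ @^-1` _ = `](c - b) / a, (d - b) / a]%classic); last first.
    apply/seteqP; split=> x /=; rewrite !in_itv/= ler_pdivlMr// ltr_pdivrMr//;
    by rewrite ltrBlDr lerBrDr [x * a]mulrC.
  rewrite !lebesgue_measure_itv /= !lte_fin ltr_pM2r ?invr_gt0// ltrD2r.
  case: ifPn => _; last by rewrite mule0.
  by rewrite -!EFinD -EFinM gtr0_norm//; congr (_%:E); field; rewrite gt_eqF.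
- rewrite (_ : _ @^-1` _ = `[(d - b) / a, (c - b) / a[%classic); last first.
    apply/seteqP; split=> x /=; rewrite !in_itv/= ler_ndivrMr// ltr_ndivlMr//;
    by rewrite ltrBlDr lerBrDr [x * a]mulrC andbC.
  rewrite !lebesgue_measure_itv /= !lte_fin ltr_nM2r ?invr_lt0// ltrD2r.
  case: ifPn => _; last by rewrite mule0.
  by rewrite -!EFinD -EFinM ltr0_norm//; congr (_%:E); field; rewrite lt_eqF.
Qed.

Lemma ge0_integral_affine (a b : R) (f : mR -> \bar R) : a != 0 ->
  measurable_fun setT f -> (forall x, 0 <= f x)%E ->
  (`|a|%:E * \int[mu]_x f (a * x + b)%R = \int[mu]_x f x)%E.
Proof.
move=> a0 mf f0; have an0 : 0 <= `|a| by [].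
have maff := measurable_affine a b.
have f0' : {in [set: mR], forall y, (0 <= f y)%E} by move=> x _; exact: f0.
have := ge0_integral_pushforward maff mu measurableT mf f0'.
rewrite preimage_setT => <-.
have -> : (`|a|%:E = (NngNum an0)%:num%:E)%E by [].
rewrite -ge0_integral_mscale//.
apply: eq_measure_integral => A mA _ /=.
exact: lebesgue_measure_affine.
Qed.

End affine_substitution.

Section density.
Context (R : realType) (disp : measure_display) (T : measurableType disp).
Context (mu nu : {measure set T -> \bar R}) (g : T -> R).
Hypotheses (mg : measurable_fun setT g) (g0 : forall x, 0 <= g x).
Hypothesis nuE : forall A, measurable A -> nu A = (\int[mu]_(x in A) (g x)%:E)%E.

Import HBNNSimple.

Let integral_density_nnsfun (s : {nnsfun T >-> R}) :
  (\int[nu]_x (s x)%:E = \int[mu]_x ((s x)%:E * (g x)%:E))%E.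
Proof.
under [LHS]eq_integral do rewrite fimfunE -fsumEFin//.
rewrite [LHS]ge0_integral_fsum//; last 2 first.
  by move=> r; exact/measurable_EFinP/measurableT_comp.
  by move=> n x _; rewrite EFinM nnfun_muleindic_ge0.
under [RHS]eq_integral.
  move=> x _; rewrite fimfunE -fsumEFin// ge0_mule_fsuml; last first.
    by move=> r; rewrite EFinM nnfun_muleindic_ge0.
  over.
rewrite [RHS]ge0_integral_fsum//; last 2 first.
  move=> r; apply: emeasurable_funM; last exact/measurable_EFinP.
  by apply/measurable_EFinP/measurableT_comp.
  move=> n x _; rewrite mule_ge0 ?lee_fin//.
  by have := nnfun_muleindic_ge0 s n x.
apply: eq_fsbigr => r _.
rewrite integralZl_indic_nnsfun// integral_indic//= setIT nuE//.
have [r0|r0] := leP 0 r; last first.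
  rewrite [s @^-1` _](_ : _ = set0); last first.
    by apply/seteqP; split=> // x /= sxr; move: r0; rewrite -sxr ltNge fun_ge0.
  rewrite integral_set0 mule0; apply/esym/integral0_eq => x _.
  by rewrite indic0 mulr0 mul0e.
rewrite integral_mkcond -ge0_integralZl//=.
- apply: eq_integral => x _; rewrite patchE indicE.
  by case: ifPn => _; rewrite ?mulr1 ?mulr0 ?mule0 ?mul0e.
- by apply/(measurable_restrictT _ _).1 => //; exact/measurable_funTS/measurable_EFinP.
- by move=> x _; apply: erestrict_ge0 => y _; rewrite lee_fin.
Qed.

Lemma ge0_integral_density (f : T -> \bar R) : measurable_fun setT f ->
  (forall x, 0 <= f x)%E ->
  (\int[nu]_x f x = \int[mu]_x (f x * (g x)%:E))%E.
Proof.
move=> mf f0; pose f_ := nnsfun_approx measurableT mf.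
have f0' x : [set: T] x -> (0 <= f x)%E by [].
have fE x : f x = limn (fun n => (f_ n x)%:E).
  by apply/esym/cvg_lim => //; apply: cvg_nnsfun_approx.
transitivity (limn (fun n => \int[nu]_x (f_ n x)%:E))%E.
  rewrite -monotone_convergence//.
  - by apply: eq_integral => x _; exact: fE.
  - by move=> n; exact/measurable_EFinP/measurable_funP.
  - by move=> n y _; rewrite lee_fin.
  - by move=> y _ m n mn; rewrite lee_fin; exact/lefP/nd_nnsfun_approx.
under eq_fun do rewrite integral_density_nnsfun.
rewrite -monotone_convergence//.
- apply: eq_integral => x _; apply/cvg_lim => //.
  apply: cvgeZr => //; exact: cvg_nnsfun_approx.
- move=> n; apply: emeasurable_funM; apply/measurable_EFinP => //.
- by move=> n y _; rewrite mule_ge0// lee_fin.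
- move=> y _ m n mn; rewrite lee_wpmul2r ?lee_fin//.
  by exact/lefP/nd_nnsfun_approx.
Qed.

End density.

(** * The Gaussian measure on the line *)

Section gaussian_line.
Context (R : realType).
Local Notation mR := (measurableTypeR R).
Local Notation mu := (@lebesgue_measure R).
Local Notation gamma := (gamma R).

Definition gauss_pdf (x : R) : R := normal_pdf 0 1 x.
Local Notation phi := gauss_pdf.

Lemma gauss_pdfE x : phi x = normal_peak 1 * expR (- (x ^+ 2 / 2)).
Proof.
rewrite /phi normal_pdfE ?oner_eq0// /normal_fun subr0 expr1n mulNr.
by congr (_ * expR (- (_ / _))); rewrite mulr2n.
Qed.

Lemma gauss_pdf_gt0 x : 0 < phi x.
Proof. by rewrite gauss_pdfE mulr_gt0 ?expR_gt0// normal_peak_gt0// oner_eq0. Qed.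

Lemma gauss_pdf_ge0 x : 0 <= phi x.
Proof. exact/ltW/gauss_pdf_gt0. Qed.

Lemma gauss_pdf_le_peak x : phi x <= normal_peak 1.
Proof. by apply: normal_pdf_ub; exact: oner_neq0. Qed.

Lemma measurable_gauss_pdf : measurable_fun [set: mR] phi.
Proof. exact: measurable_normal_pdf. Qed.

Lemma gauss_pdfN x : phi (- x) = phi x.
Proof. by rewrite !gauss_pdfE sqrrN. Qed.

(** For r >= 0 the factor is nonincreasing in x; this monotonicity drives [gauss_cdf_shift_le]. *)
Lemma gauss_pdf_shift x r : phi (x + r) = phi x * expR (- (x * r + r ^+ 2 / 2)).
Proof.
rewrite !gauss_pdfE -[RHS]mulrA -expRD; congr (_ * expR _); by field.
Qed.

Lemma gammaE (A : set mR) : gamma A = (\int[mu]_(x in A) (phi x)%:E)%E.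
Proof. by []. Qed.

Lemma ge0_integral_gamma (f : mR -> \bar R) : measurable_fun setT f ->
  (forall x, 0 <= f x)%E ->
  (\int[gamma]_x f x = \int[mu]_x (f x * (phi x)%:E))%E.
Proof.
apply: ge0_integral_density; [exact: measurable_gauss_pdf|exact: gauss_pdf_ge0|].
by [].
Qed.

(** One statement for translations and for the reflection; with [|a| = 1] no Jacobian appears. *)
Lemma gamma_affine (a r : R) (A : set mR) : `|a| = 1 -> measurable A ->
  gamma A = (\int[mu]_(x in (fun x => (a * x + r)%R) @^-1` A) (phi (a * x + r))%:E)%E.
Proof.
move=> a1 mA; have a0 : a != 0 by rewrite -normr_eq0 a1 oner_neq0.
rewrite gammaE integral_mkcond -(@ge0_integral_affine _ a r)//.
- rewrite a1 mul1e [RHS]integral_mkcond; apply: eq_integral => x _ /=.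
  by rewrite !patchE; congr (if _ then _ else _).
- apply/(measurable_restrictT _ _).1 => //.
  by apply/measurable_funTS/measurable_EFinP; exact: measurable_gauss_pdf.
- by move=> x; apply: erestrict_ge0 => y _; rewrite lee_fin gauss_pdf_ge0.
Qed.

Lemma gamma_set1 x : gamma [set x] = 0%E.
Proof.
by rewrite gammaE integral_set1.
Qed.

Lemma gamma_fin (A : set mR) : measurable A -> gamma A \is a fin_num.
Proof. by move=> mA; exact: fin_num_measure. Qed.

Lemma gammaN (A : set mR) : measurable A ->
  gamma ((fun x => - x) @^-1` A) = gamma A.
Proof.
move=> mA; rewrite [RHS](gamma_affine 0 (normrN1 R) mA) gammaE.
rewrite (_ : (fun x => -1 * x + 0) @^-1` A = (fun x => - x) @^-1` A).
  by apply: eq_integral => x _; rewrite addr0 mulN1r gauss_pdfN.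
by apply/seteqP; split=> x /=; rewrite addr0 mulN1r.
Qed.

Definition gauss_cdf (x : R) : R := fine (Phi x).
Local Notation G := gauss_cdf.

Lemma PhiE x : Phi x = (G x)%:E.
Proof. by rewrite fineK// gamma_fin. Qed.

Lemma gamma_Nyo x : gamma `]-oo, x[%classic = (G x)%:E.
Proof. exact: PhiE. Qed.

Lemma gamma_Nyc x : gamma `]-oo, x]%classic = (G x)%:E.
Proof.
rewrite -(setUitv1 true)// measureU//=.
- by rewrite gamma_set1 adde0 gamma_Nyo.
- by apply/seteqP; split=> // y /= [] /[swap] ->; rewrite in_itv/= ltxx.
Qed.

Lemma gauss_cdf_ge0 x : 0 <= G x.
Proof. by rewrite -lee_fin -PhiE measure_ge0. Qed.

Lemma gamma_oy x : gamma `]x, +oo[%classic = (1 - G x)%:E.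
Proof.
rewrite -setCitvl probability_setC//= gamma_Nyc.
by rewrite EFinB.
Qed.

Lemma gauss_cdfN x : G (- x) = 1 - G x.
Proof.
apply: EFin_inj; rewrite -gamma_oy -gamma_Nyo -gammaN//; congr (gamma _).
by apply/seteqP; split=> y /=; rewrite !in_itv/= ltrN2 andbT.
Qed.

Lemma gamma_co a b : a <= b -> gamma `[a, b[%classic = (G b - G a)%:E.
Proof.
move=> ab; have : ((G b)%:E = (G a)%:E + gamma `[a, b[%classic)%E.
  rewrite -!PhiE /Phi -measureU//=.
    by congr (gamma _); rewrite -itv_bndbnd_setU ?bnd_simp.
  apply/seteqP; split=> // y /= []; rewrite !in_itv/= => ya /andP[ay _].
  by move: (lt_le_trans ya ay); rewrite ltxx.
by move=> Gb; rewrite EFinB Gb addeAC subee// add0e.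
Qed.

End gaussian_line.

(** * The Gaussian distribution function: continuity, range, and behaviour under shifts *)

Section gauss_cdf_theory.
Context (R : realType).
Local Notation mR := (measurableTypeR R).
Local Notation mu := (@lebesgue_measure R).
Local Notation gamma := (gamma R).
Local Notation phi := (@gauss_pdf R).
Local Notation G := (@gauss_cdf R).

Lemma gamma_co_pdf (a b : R) :
  (gamma `[a, b[%classic = \int[mu]_(x in `[a, b[) (phi x)%:E)%E.
Proof. by []. Qed.

Lemma gamma_co_shift (a b r : R) :
  (gamma `[(a + r)%R, (b + r)%R[%classic = \int[mu]_(x in `[a, b[) (phi (x + r))%:E)%E.
Proof.
rewrite (gamma_affine r (normr1 R) (measurable_itv _)).
rewrite (_ : (fun x => 1 * x + r) @^-1` _ = `[a, b[%classic).
  by apply: eq_integral => x _; rewrite mul1r.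
by apply/seteqP; split=> x /=; rewrite !in_itv/= mul1r lerD2r ltrD2r.
Qed.

Lemma gamma_No_shift (a r : R) :
  (gamma `]-oo, (a + r)%R[%classic = \int[mu]_(x in `]-oo, a[) (phi (x + r))%:E)%E.
Proof.
rewrite (gamma_affine r (normr1 R) (measurable_itv _)).
rewrite (_ : (fun x => 1 * x + r) @^-1` _ = `]-oo, a[%classic).
  by apply: eq_integral => x _; rewrite mul1r.
by apply/seteqP; split=> x /=; rewrite !in_itv/= mul1r ltrD2r.
Qed.

Lemma gauss_cdf_nondecreasing (a b : R) : a <= b -> G a <= G b.
Proof.
by move=> ab; rewrite -subr_ge0 -lee_fin -gamma_co// measure_ge0.
Qed.

Let mphi (D : set R) (r : R) : measurable_fun D (fun x => (phi (x + r))%:E).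
Proof.
apply/measurable_funTS/measurable_EFinP.
apply: (@measurableT_comp _ _ _ mR mR mR) => //; first exact: measurable_gauss_pdf.
exact: measurable_funD.
Qed.

Let mphi0 (D : set R) : measurable_fun D (fun x => (phi x)%:E).
Proof.
by apply/measurable_funTS/measurable_EFinP; exact: measurable_gauss_pdf.
Qed.

Lemma gauss_cdf_lipschitz (a b : R) : a <= b ->
  G b - G a <= normal_peak 1 * (b - a).
Proof.
move=> ab; rewrite -lee_fin -gamma_co// gamma_co_pdf.
have -> : (normal_peak 1 * (b - a))%:E =
    (\int[mu]_(x in `[a, b[) (cst (normal_peak 1)%:E x))%E.
  rewrite integral_cst//= lebesgue_measure_itv/= lte_fin EFinM.
  case: ltP => // ba; rewrite (le_anti (introT andP (conj ab ba))).
  by rewrite subrr.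
apply: ge0_le_integral => //. all: try by [exact: mphi0|exact: measurable_cst].
- by move=> x _; rewrite lee_fin gauss_pdf_ge0.
- by move=> x _; rewrite lee_fin gauss_pdf_le_peak.
Qed.

Lemma gauss_cdf_increasing (a b : R) : a < b -> G a < G b.
Proof.
move=> ab; rewrite -subr_gt0 -lte_fin -gamma_co ?ltW// gamma_co_pdf.
pose m := normal_peak 1 * expR (- (`|a| + `|b|) ^+ 2 / 2) : R.
have m0 : 0 < m by rewrite mulr_gt0 ?expR_gt0// normal_peak_gt0// oner_eq0.
apply: (@lt_le_trans _ _ (\int[mu]_(x in `[a, b[) (cst m%:E x))%E).
  rewrite integral_cst//= lebesgue_measure_itv/= lte_fin ab -EFinD -EFinM lte_fin.
  by rewrite mulr_gt0// subr_gt0.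
apply: ge0_le_integral => //. all: try by [exact: mphi0|exact: measurable_cst].
- by move=> x _; rewrite lee_fin ltW.
- move=> x /=; rewrite in_itv/= => /andP[ax xb].
  rewrite lee_fin gauss_pdfE ler_wpM2l ?normal_peak_ge0// ler_expR.
  rewrite mulNr lerN2 ler_pM2r// -real_normK ?num_real// ler_sqr ?nnegrE ?addr_ge0//.
  rewrite ler_norml; apply/andP; split.
    have := ler_norm (- a); rewrite normrN; have := normr_ge0 b; lra.
  have := ler_norm b; have := normr_ge0 a; lra.
Qed.

Lemma ltr_gauss_cdf (a b : R) : (G a < G b) = (a < b).
Proof.
apply/idP/idP; last exact: gauss_cdf_increasing.
by apply: contraTT; rewrite -!leNgt; exact: gauss_cdf_nondecreasing.
Qed.

Lemma ler_gauss_cdf (a b : R) : (G a <= G b) = (a <= b).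
Proof. by rewrite leNgt ltr_gauss_cdf -leNgt. Qed.

Lemma continuous_gauss_cdf : continuous G.
Proof.
move=> x; apply/cvgrPdist_lt => e e0.
have p0 : 0 < normal_peak 1 :> R by rewrite normal_peak_gt0// oner_eq0.
near=> y.
have xy : `|x - y| < e / normal_peak 1.
  near: y; apply: (@cvgr_dist_lt _ _ _ _ _ id x) => //.
  by rewrite divr_gt0.
rewrite ltr_pdivlMr// mulrC in xy; apply: le_lt_trans xy.
have [le|le] := leP x y.
  rewrite distrC [X in _ <= _ * X]distrC !ger0_norm ?subr_ge0//; last first.
    exact: gauss_cdf_nondecreasing.
  exact: gauss_cdf_lipschitz.
have {}le := ltW le.
rewrite !ger0_norm ?subr_ge0//; last exact: gauss_cdf_nondecreasing.
exact: gauss_cdf_lipschitz.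
Unshelve. all: by end_near. Qed.

Lemma gauss_cdf_near1 (e : R) : 0 < e -> exists x, 1 - e < G x.
Proof.
move=> e0; have : gamma (`]-oo, n%:R[%classic) @[n --> \oo] -->
    gamma (\bigcup_n `]-oo, n%:R[%classic).
  apply: nondecreasing_cvg_mu => //.
    exact: bigcup_measurable.
  move=> m n mn; apply/subsetPset => x /=; rewrite !in_itv/= => /lt_le_trans; apply.
  by rewrite ler_nat.
rewrite (_ : \bigcup_n _ = setT); last first.
  apply/seteqP; split=> // x _; exists (Num.bound `|x|) => //=.
  rewrite in_itv/= (le_lt_trans (ler_norm _))//.
  exact: archi_boundP.
rewrite probability_setT => /fine_cvgP[_ /cvgrPdist_lt/(_ _ e0)[n _ /(_ n)]].
move=> /(_ (leqnn n))/=; rewrite gamma_Nyo/= => Gn; exists n%:R.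
by move: Gn; rewrite ltr_norml => /andP[_]; lra.
Qed.

Lemma gauss_cdf_lt1 (x : R) : G x < 1.
Proof.
apply: (@lt_le_trans _ _ (G (x + 1))).
  by apply: gauss_cdf_increasing; rewrite ltrDl.
by rewrite -lee_fin -PhiE probability_le1.
Qed.

Lemma gauss_cdf_gt0 (x : R) : 0 < G x.
Proof. by have := gauss_cdf_lt1 (- x); rewrite gauss_cdfN; lra. Qed.

Lemma gauss_cdf_near0 (e : R) : 0 < e -> exists x, G x < e.
Proof.
by move=> /gauss_cdf_near1[x Gx]; exists (- x); rewrite gauss_cdfN; lra.
Qed.

Lemma gauss_cdf_onto (p : R) : 0 < p < 1 -> exists x, G x = p.
Proof.
move=> /andP[p0 p1].
have [a Ga] := gauss_cdf_near0 p0.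
have [b] : exists b, 1 - (1 - p) < G b by apply: gauss_cdf_near1; lra.
rewrite subKr => Gb.
have ab : a <= b by rewrite -ler_gauss_cdf ltW// (lt_trans Ga).
have [||c _ <-] := @IVT R G a b p ab; last by exists c.
  exact/continuous_subspaceT/continuous_gauss_cdf.
by rewrite ge_min (ltW Ga)/= le_max (ltW Gb) orbT.
Qed.

(** Under [gamma] the variable G is uniform on the unit interval. Describing the half-line of
    measure p through G covers p = 0 and p = 1, where its end point is infinite. *)
Lemma gamma_cdf_lt (p : \bar R) : (0 <= p <= 1)%E ->
  gamma [set y | ((G y)%:E < p)%E] = p.
Proof.
case: p => [p||]//; last by rewrite leNgt.
rewrite !lee_fin => /andP[].
rewrite le_eqVlt => /predU1P[<- _|p0].
  rewrite (_ : [set _ | _] = set0) ?measure0//.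
  by apply/seteqP; split=> // y /=; rewrite lte_fin ltNge gauss_cdf_ge0.
rewrite le_eqVlt => /predU1P[->|p1].
  rewrite (_ : [set _ | _] = setT) ?probability_setT//.
  by apply/seteqP; split=> // y _ /=; rewrite lte_fin gauss_cdf_lt1.
have [|x <-] := @gauss_cdf_onto p; first by rewrite p0.
rewrite -[RHS]gamma_Nyo; congr (gamma _).
by apply/seteqP; split=> y; rewrite /= lte_fin ltr_gauss_cdf in_itv.
Qed.

Lemma gamma_cdf_le (p : \bar R) : (0 <= p <= 1)%E ->
  gamma [set y | ((G y)%:E <= p)%E] = p.
Proof.
case: p => [p||]//; last by rewrite leNgt.
rewrite !lee_fin => /andP[].
rewrite le_eqVlt => /predU1P[<- _|p0].
  rewrite (_ : [set _ | _] = set0) ?measure0//.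
  by apply/seteqP; split=> // y /=; rewrite lee_fin leNgt gauss_cdf_gt0.
rewrite le_eqVlt => /predU1P[->|p1].
  rewrite (_ : [set _ | _] = setT) ?probability_setT//.
  by apply/seteqP; split=> // y _ /=; rewrite lee_fin ltW// gauss_cdf_lt1.
have [|x <-] := @gauss_cdf_onto p; first by rewrite p0.
rewrite -[RHS]gamma_Nyc; congr (gamma _).
by apply/seteqP; split=> y; rewrite /= lee_fin ler_gauss_cdf in_itv.
Qed.

(** Let a <= b < c. The mass of [b, c) is at most that of the half-line below a. A shift by r
    multiplies the density by w, which is at most w b on [b, c) and at least w a >= w b below a, so
    the comparison survives. *)
Lemma gauss_cdf_shift_le (a b c r : R) : 0 <= r ->
  G c <= G a + G b -> G (c + r) <= G (a + r) + G (b + r).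
Proof.
wlog ab : a b / a <= b => [hw r0 cab|].
  have [ab|/ltW ba] := leP a b; first exact: hw.
  by rewrite [leRHS]addrC; apply: hw => //; rewrite [leRHS]addrC.
move=> r0 cab.
have [cb|/ltW bc] := leP c b.
  have : G (c + r) <= G (b + r) by apply: gauss_cdf_nondecreasing; rewrite lerD2r.
  by have := gauss_cdf_ge0 (a + r); lra.
pose w x := expR (- (x * r + r ^+ 2 / 2)) : R.
have w_anti x y : x <= y -> w y <= w x.
  by move=> xy; rewrite ler_expR lerN2 lerD2r ler_wpM2r.
have w0 x : 0 < w x by exact: expR_gt0.
have Gcb : G (c + r) - G (b + r) <= w b * (G c - G b).
  rewrite -lee_fin EFinM -!gamma_co ?lerD2r// gamma_co_shift gamma_co_pdf.
  rewrite -ge0_integralZl//; last 3 first.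
    exact: mphi0.
    by move=> x _; rewrite lee_fin gauss_pdf_ge0.
    by rewrite lee_fin ltW.
  apply: ge0_le_integral => //.
  - by move=> x _; rewrite lee_fin gauss_pdf_ge0.
  - exact: mphi.
  - by apply: measurable_funeM; exact: mphi0.
  - move=> x /=; rewrite in_itv/= => /andP[bx _]; rewrite -EFinM lee_fin.
    by rewrite gauss_pdf_shift mulrC ler_wpM2r ?gauss_pdf_ge0// w_anti.
have Ga : w a * G a <= G (a + r).
  rewrite -lee_fin EFinM -!gamma_Nyo gamma_No_shift gammaE.
  rewrite -ge0_integralZl//; last 3 first.
    exact: mphi0.
    by move=> x _; rewrite lee_fin gauss_pdf_ge0.
    by rewrite lee_fin ltW.
  apply: ge0_le_integral => //.
  - by move=> x _; rewrite -EFinM lee_fin mulr_ge0// ?gauss_pdf_ge0// ltW.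
  - by apply: measurable_funeM; exact: mphi0.
  - exact: mphi.
  - move=> x /=; rewrite in_itv/= => xa; rewrite -EFinM lee_fin.
    by rewrite gauss_pdf_shift mulrC ler_wpM2l ?gauss_pdf_ge0// w_anti// ltW.
have : w b * (G c - G b) <= w a * G a.
  apply: (@le_trans _ _ (w b * G a)); first by rewrite ler_pM2l//; lra.
  by rewrite ler_wpM2r ?gauss_cdf_ge0// w_anti.
lra.
Qed.

(** The previous inequality read backwards: if the sum were G c' with c' > c - r, shifting by r
    would give G (c' + r) <= G a + G b <= G c. *)
Lemma gauss_cdf_shift_ge (a b c r : R) : 0 <= r ->
  G a + G b <= G c -> G (a - r) + G (b - r) <= G (c - r).
Proof.
move=> r0 abc; rewrite leNgt; apply/negP => cab.
have p1 : G (a - r) + G (b - r) < 1.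
  apply: le_lt_trans (gauss_cdf_lt1 c); apply: le_trans abc.
  by rewrite lerD// ler_gauss_cdf gerBl.
have [|c' c'E] := @gauss_cdf_onto (G (a - r) + G (b - r)).
  by rewrite p1 addr_gt0 ?gauss_cdf_gt0.
have cc' : c - r < c' by rewrite -ltr_gauss_cdf c'E.
have := @gauss_cdf_shift_le (a - r) (b - r) c' r r0.
rewrite c'E !subrK => /(_ (lexx _)) /le_trans/(_ abc).
by rewrite ler_gauss_cdf; lra.
Qed.

(** The complement of an interval consists of two half-lines that retreat by r, so
    [gauss_cdf_shift_ge] applies to a, - b and - c. *)
Lemma gamma_itv_enlarge (a b c r : R) : 0 <= r -> a <= b ->
  ((G c)%:E <= gamma `[a, b]%classic ->
   (G (c + r))%:E <= gamma `](a - r)%R, (b + r)%R[%classic)%E.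
Proof.
move=> r0 ab.
have ccE x y : x <= y -> gamma `[x, y]%classic = (G y - G x)%:E.
  move=> xy; rewrite -(setUitv1 true) ?bnd_simp// measureU//=.
  - by rewrite gamma_set1 adde0 gamma_co.
  - by apply/seteqP; split=> // z /= [] /[swap] ->; rewrite in_itv/= ltxx andbF.
rewrite ccE// lee_fin => cab.
have : G (a - r) + G (- b - r) <= G (- c - r).
  by apply: gauss_cdf_shift_ge => //; rewrite !gauss_cdfN; lra.
rewrite -!opprD !gauss_cdfN => H.
have [arbr|brar] := ltP (a - r) (b + r); last first.
  have ba : b = a by lra.
  by exfalso; move: cab (gauss_cdf_gt0 c); rewrite ba; lra.
have : (gamma `[(a - r)%R, (b + r)%R[%classic <=
        gamma `](a - r)%R, (b + r)%R[%classic)%E.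
  rewrite -(setU1itv false) ?bnd_simp//.
  by rewrite (le_trans (measureU2 _ _ _))//= gamma_set1 add0e.
by apply: le_trans; rewrite (gamma_co (ltW arbr)) lee_fin; lra.
Qed.

End gauss_cdf_theory.

(** * Isoperimetry on the line *)

(** [D] is a squared distance, hence the comparison with r ^ 2: squared distances simply add up in a
    product, and no square root is needed. *)
Definition enlarge (R : realType) (T : Type) (D : T -> T -> R) (r : R)
  (A : set T) : set T := [set t | exists2 a, A a & D t a < r ^+ 2].

(** Stated with a lower bound G c instead of the inverse distribution function, so that sets of
    measure 0 or 1 need no infinite end points. *)
Definition isoperimetric (R : realType) (disp : measure_display)
    (T : measurableType disp) (mu : set T -> \bar R) (D : T -> T -> R) :=
  forall (A : set T) (c r : R), measurable A -> 0 < r ->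
    ((gauss_cdf c)%:E <= mu A -> (gauss_cdf (c + r))%:E <= mu (enlarge D r A))%E.

Definition sqdist (R : realType) (x y : R) : R := (x - y) ^+ 2.

Section isoperimetry_line.
Context (R : realType).
Local Notation mR := (measurableTypeR R).
Local Notation gamma := (gamma R).
Local Notation G := (@gauss_cdf R).
Implicit Types (s : seq (R * R)) (r : R).

Let cl s : set mR := [set x | has (fun I : R * R => x \in `[I.1, I.2]) s].
Let op r s : set mR :=
  [set x | has (fun I : R * R => x \in `](I.1 - r), (I.2 + r)[) s].

Let cl_cons I s : cl (I :: s) = `[I.1, I.2]%classic `|` cl s.
Proof. by apply/seteqP; split=> x /= /orP. Qed.

Let op_cons r I s : op r (I :: s) = `](I.1 - r), (I.2 + r)[%classic `|` op r s.
Proof. by apply/seteqP; split=> x /= /orP. Qed.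

Let mcl s : measurable (cl s).
Proof.
elim: s => [|I s IH]; last by rewrite cl_cons; exact: measurableU.
by rewrite (_ : cl [::] = set0)//; apply/seteqP; split.
Qed.

Let mop r s : measurable (op r s).
Proof.
elim: s => [|I s IH]; last by rewrite op_cons; exact: measurableU.
by rewrite (_ : op r [::] = set0)//; apply/seteqP; split.
Qed.

Let subset_op r s : 0 < r -> all (fun I : R * R => I.1 <= I.2) s ->
  cl s `<=` op r s.
Proof.
move=> r0 _ x /hasP[I Is]; rewrite in_itv/= => /andP[Ix xI].
by apply/hasP; exists I => //; rewrite in_itv/=; apply/andP; split; lra.
Qed.

(* Overlapping enlargements are merged into one interval; disjoint ones are
   handled by the subadditivity [gauss_cdf_shift_le]. *)
Let isoperimetric_itvs r s c : 0 < r -> all (fun I : R * R => I.1 <= I.2) s ->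
  ((G c)%:E <= gamma (cl s) -> (G (c + r))%:E <= gamma (op r s))%E.
Proof.
(* Induction on the length, with c free: merging two intervals yields a shorter list that is not a
   sublist, and splitting one off changes c. *)
move=> r0; move: {2}(size s) (leqnn (size s)) c => n.
elim: n s => [[|//] _ c _|n IH [_ c _|I s ss c]].
- rewrite (_ : cl [::] = set0) ?measure0 ?lee_fin; last by apply/seteqP; split.
  by rewrite leNgt gauss_cdf_gt0.
- rewrite (_ : cl [::] = set0) ?measure0 ?lee_fin; last by apply/seteqP; split.
  by rewrite leNgt gauss_cdf_gt0.
move=> /[dup] als /= /andP[I12 sle].
have [/hasP[J Js /andP[IJ JI]]|/hasPn disj] :=
    boolP (has (fun J : R * R => (I.1 - r < J.2 + r) && (J.1 - r < I.2 + r)) s).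
  have J12 := allP sle _ Js.
  pose K := (Num.min I.1 J.1, Num.max I.2 J.2).
  have sE : perm_eq s (J :: rem J s) := perm_to_rem Js.
  move=> Gc; apply: (@le_trans _ _ (gamma (op r (K :: rem J s)))).
    apply: IH.
    - by rewrite /= size_rem//; move: ss; rewrite ltnS; case: (s) Js.
    - rewrite /= ge_min !le_max I12/=; apply/allP => L /mem_rem Ls.
      exact: (allP sle).
    - apply: le_trans Gc _; apply: le_measure; rewrite ?inE//.
      move=> x; rewrite !cl_cons => -[/=|].
        rewrite !in_itv/= => /andP[Ix xI]; left.
        by rewrite ge_min Ix le_max xI.
      rewrite /cl/= (perm_has _ sE)/= => /orP[|xs]; last by right.
      rewrite !in_itv/= => /andP[Jx xJ]; left.
      by rewrite ge_min Jx le_max xJ !orbT.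
  apply: le_measure; rewrite ?inE//.
  move=> x; rewrite (op_cons r K) => -[|xs]; last first.
    by rewrite /op/= (perm_has _ sE)/= [X in _ || (_ || X)]xs !orbT.
  rewrite /op /= !in_itv/= => /andP[Kx xK]; rewrite (perm_has _ sE)/= !in_itv/= orbA.
  apply/orP; left.
  move: Kx xK; rewrite /Num.min /Num.max /K/=.
  case: ifPn => IJ1; case: ifPn => IJ2 => Kx xK.
  + have [xI|xI] := ltP x (I.2 + r); first by rewrite Kx.
    by rewrite xK andbT; apply/orP; right; lra.
  + by move: IJ2; rewrite -leNgt => IJ2; rewrite Kx xK.
  + by rewrite Kx xK orbT.
  + move: IJ1 IJ2; rewrite -!leNgt => IJ1 IJ2.
    have [xI|xI] := ltP x (J.2 + r); first by rewrite Kx orbT.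
    by rewrite xK andbT; apply/orP; left; lra.
have opI : gamma (op r (I :: s)) =
    (gamma `](I.1 - r)%R, (I.2 + r)%R[%classic + gamma (op r s))%E.
  rewrite op_cons measureU//; apply/seteqP; split=> // x [] /=.
  rewrite in_itv/= => /andP[Ix xI] /hasP[J Js]; rewrite in_itv/= => /andP[Jx xJ].
  by have := disj _ Js; rewrite (lt_trans Ix xJ) (lt_trans Jx xI).
have clI : (gamma (cl (I :: s)) <= gamma `[I.1, I.2]%classic + gamma (cl s))%E.
  by rewrite cl_cons; apply: measureU2.
have IHI c' := @gamma_itv_enlarge R I.1 I.2 c' r (ltW r0) I12.
have IHs c' := IH s ss c' sle.
have fI : gamma `[I.1, I.2]%classic \is a fin_num by exact: gamma_fin.
have fs : gamma (cl s) \is a fin_num by exact: gamma_fin.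
(* If both masses are positive, this bound puts each of them strictly below 1, so that both are
   values of G. A zero mass is not a value of G and is treated apart. *)
have disj_sum : (gamma `[I.1, I.2]%classic + gamma (cl s) <= 1)%E.
  apply: (@le_trans _ _ (gamma (op r (I :: s)))); last exact: probability_le1.
  rewrite opI leeD// le_measure ?inE//; last exact: subset_op.
  by move=> x /=; rewrite !in_itv/= => /andP[? ?]; apply/andP; split; lra.
rewrite opI => Gc; have {Gc clI} := le_trans Gc clI.
move: IHI IHs disj_sum; rewrite -(fineK fI) -(fineK fs).
have pI : 0 <= fine (gamma `[I.1, I.2]%classic) by rewrite fine_ge0.
have ps : 0 <= fine (gamma (cl s)) by rewrite fine_ge0.
move: (fine (gamma `[I.1, I.2]%classic)) (fine (gamma (cl s))) pI ps => p q p0 q0.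
rewrite -!EFinD !lee_fin => IHI IHs pq1 Gc.
have [pe|pn] := eqVneq p 0.
  rewrite -[leLHS]add0e; apply: leeD; first exact: measure_ge0.
  by apply: IHs; rewrite lee_fin; move: Gc; rewrite pe add0r.
have [qe|qn] := eqVneq q 0.
  rewrite -[leLHS]adde0; apply: leeD; last exact: measure_ge0.
  by apply: IHI; rewrite lee_fin; move: Gc; rewrite qe addr0.
have {pn}p0 : 0 < p by rewrite lt_neqAle eq_sym pn.
have {qn}q0 : 0 < q by rewrite lt_neqAle eq_sym qn.
have [|a aE] := @gauss_cdf_onto R p; first by apply/andP; split; lra.
have [|b bE] := @gauss_cdf_onto R q; first by apply/andP; split; lra.
apply: (@le_trans _ _ ((G (a + r))%:E + (G (b + r))%:E)%E).
  by rewrite -EFinD lee_fin; apply: gauss_cdf_shift_le; [exact: ltW|rewrite aE bE].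
by apply: leeD; [apply: IHI; rewrite aE|apply: IHs; rewrite bE].
Qed.

(** Continuity of G from the left: a bound may be proved with some room in its argument, which pays
    for discretization and tails. *)
Lemma gauss_cdf_le_left (z : R) (p : \bar R) :
  (forall y, (y < z)%R -> (G y)%:E <= p)%E -> ((G z)%:E <= p)%E.
Proof.
move=> H; apply/lee_addgt0Pr => e e0.
have p0 : 0 < normal_peak 1 :> R by rewrite normal_peak_gt0// oner_eq0.
have d0 : 0 < e / normal_peak 1 by rewrite divr_gt0.
have /H H1 : z - e / normal_peak 1 < z by rewrite ltrBlDr ltrDl.
apply: (@le_trans _ _ ((G (z - e / normal_peak 1))%:E + e%:E)%E); last exact: leeD2r.
rewrite -EFinD lee_fin -lerBlDl; apply: le_trans (gauss_cdf_lipschitz _) _.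
  by rewrite lerBlDr lerDl ltW.
by rewrite opprB addrC subrK mulrC divfK// gt_eqF.
Qed.

Lemma measurable_enlarge_line r (A : set mR) : measurable (enlarge (@sqdist R) r A).
Proof.
apply: open_measurable.
have [r0|r0] := eqVneq r 0.
  rewrite (_ : enlarge _ _ _ = set0); first exact: open0.
  by apply/seteqP; split=> // x [a _]; rewrite r0 expr0n/= ltNge sqr_ge0.
rewrite (_ : enlarge _ _ _ = \bigcup_(a in A) ball a `|r|).
  by apply: bigcup_open => a _; apply: ball_open; rewrite normr_gt0.
have sq x a : (sqdist x a < r ^+ 2) = (`|a - x| < `|r|).
  by rewrite /sqdist -[RHS]ltr_sqr ?nnegrE// !real_normK ?num_real// -sqrrN opprB.
by apply/seteqP; split=> x [a Aa xa]; exists a => //=; move: xa; rewrite /ball/= sq.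
Qed.

(** Cover the part of A in [- L, L) by the cells of a grid of mesh d that meet A. Every point of
    such a cell is within d of A, so enlarging the cells by r - d stays inside the enlargement of A
    by r. The target y = c' + (r - d) has c' < c, and this gap pays for the tails. *)
Theorem isoperimetric_line : isoperimetric gamma (@sqdist R).
Proof.
move=> A c r mA r0 Gc; apply: gauss_cdf_le_left => y ycr.
pose d := Num.min (r / 2) ((c + r - y) / 2).
have d0 : 0 < d by rewrite lt_min !divr_gt0//; lra.
have dr : d < r by rewrite gt_min; apply/orP; left; lra.
have dy : d <= (c + r - y) / 2 by rewrite ge_min lexx orbT.
pose c' := y - r + d.
have cc' : c' < c by rewrite /c'; lra.
(* Half of the gap, because both tails of mass 1 - G L are lost. *)
have e0 : 0 < (G c - G c') / 2.
  by rewrite divr_gt0// subr_gt0 gauss_cdf_increasing.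
have [L GL] := gauss_cdf_near1 e0.
pose N := Num.bound (`|L| / d).
have LN : L <= N%:R * d.
  rewrite -ler_pdivrMr// ltW//; apply: le_lt_trans (archi_boundP _).
    by rewrite ler_pM2r ?invr_gt0// ler_norm.
  by rewrite divr_ge0// ltW.
pose cell (k : nat) : R * R := ((k%:R - N%:R) * d, (k.+1%:R - N%:R) * d).
pose s := [seq cell k | k <- iota 0 N.*2 &
  `[< exists2 x, A x & (cell k).1 <= x <= (cell k).2 >]].
have cellE k : (cell k).2 = (cell k).1 + d by rewrite /cell/= -natr1; ring.
have AL : A `&` `[(- L), L[%classic `<=` cl s.
  move=> x [Ax]; rewrite /= in_itv/= => /andP[Lx xL].
  have t0 : 0 <= x / d + N%:R.
    by rewrite -lerBlDr sub0r ler_pdivlMr// mulNr; lra.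
  pose k := Num.truncn (x / d + N%:R).
  have /andP[k1 k2] := truncn_itv t0.
  have x1 : (cell k).1 <= x by rewrite /cell/= -ler_pdivlMr// lerBlDr.
  have x2 : x < (cell k).2 by rewrite /cell/= -ltr_pdivrMr// ltrBrDr.
  apply/hasP; exists (cell k); last by rewrite in_itv/= x1 ltW.
  apply/mapP; exists k => //; rewrite mem_filter; apply/andP; split.
    by apply/asboolP; exists x => //; rewrite x1 ltW.
  rewrite mem_iota add0n /= -(ltr_nat R) (le_lt_trans k1)//.
  by rewrite -addnn natrD ltrD2r ltr_pdivrMr//; lra.
have sA : op (r - d) s `<=` enlarge (@sqdist R) r A.
  move=> x /hasP[_ /mapP[k + ->]]; rewrite mem_filter => /andP[/asboolP[a Aa] + _].
  move: (cellE k); case: (cell k) => u v /= -> /andP[ua au].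
  rewrite in_itv/= => /andP[ux xu].
  exists a => //; rewrite /sqdist -real_normK ?num_real//.
  rewrite ltr_sqr ?nnegrE ?(ltW r0)//.
  by rewrite ltr_norml; apply/andP; split; lra.
have ls : all (fun I : R * R => I.1 <= I.2) s.
  by apply/allP => I /mapP[j jP ->]; rewrite cellE lerDl ltW.
have -> : y = c' + (r - d) by rewrite /c'; ring.
apply: (@le_trans _ _ (gamma (op (r - d) s))); last first.
  by apply: le_measure; rewrite ?inE//; exact: measurable_enlarge_line.
apply: isoperimetric_itvs => //; first by rewrite subr_gt0.
apply: (@le_trans _ _ (gamma (A `&` `[(- L)%R, L[%classic))); last first.
  by apply: le_measure; rewrite ?inE//; exact: measurableI.
have cyE : gamma `[L, +oo[%classic = (1 - G L)%:E.
  by rewrite -setCitvl probability_setC//= gamma_Nyo EFinB.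
have fA : gamma (A `&` `[(- L)%R, L[%classic) \is a fin_num.
  by apply: gamma_fin; exact: measurableI.
have : (gamma A <= gamma (A `&` `[(- L)%R, L[%classic) +
    (gamma `]-oo, (- L)%R[%classic + gamma `[L, +oo[%classic))%E.
  apply: (@le_trans _ _ (gamma ((A `&` `[(- L)%R, L[%classic) `|`
      (`]-oo, (- L)%R[%classic `|` `[L, +oo[%classic)))).
    apply: le_measure; rewrite ?inE//.
      by apply: measurableU; [exact: measurableI|exact: measurableU].
    move=> x Ax; have [xL|Lx] := ltP x (- L); first by right; left; rewrite /= in_itv.
    have [xL|Lx'] := ltP x L; first by left; split => //=; rewrite in_itv/= Lx.
    by right; right; rewrite /= in_itv/= Lx'.
  apply: le_trans (measureU2 _ _ _) _ => //; [exact: measurableI|exact: measurableU|].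
  by apply: leeD => //; apply: measureU2.
move=> /(le_trans Gc); rewrite gamma_Nyo cyE gauss_cdfN -(fineK fA).
by rewrite -!EFinD !lee_fin; lra.
Qed.

End isoperimetry_line.

(** * Ehrhard symmetrization *)

Definition prod_dist (R : realType) (T : Type) (D : T -> T -> R)
  (p q : R * T) : R := (p.1 - q.1) ^+ 2 + D p.2 q.2.

Section gaussian_symmetrization.
Context (R : realType).
Local Notation mR := (measurableTypeR R).
Local Notation gamma := (gamma R).
Local Notation G := (@gauss_cdf R).
Context (disp : measure_display) (T : measurableType disp).
Context (mu : probability T R) (D : T -> T -> R).

(** The section over x is the half-line with the measure of the section of A, written through G so
    that null and full sections are included. *)
Definition symmetrization (A : set (mR * T)) : set (mR * mR) :=
  [set p | ((G p.2)%:E < mu (xsection A p.1))%E].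

Lemma measurable_gauss_cdf : measurable_fun [set: mR] (G : mR -> mR).
Proof.
apply: nondecreasing_measurable => //.
by move=> x y xy; exact: gauss_cdf_nondecreasing.
Qed.

Lemma xsection_symmetrization A x :
  xsection (symmetrization A) x = [set y | ((G y)%:E < mu (xsection A x))%E].
Proof. by apply/seteqP; split=> y /=; rewrite /xsection/= inE. Qed.

Lemma measurable_symmetrization A : measurable A -> measurable (symmetrization A).
Proof.
move=> mA; pose q (p : mR * mR) : mR := fine (mu (xsection A p.1)).
have mq : measurable_fun setT q.
  apply: (@measurableT_comp _ _ _ _ _ _ (fun x : mR => fine (mu (xsection A x)))) => //.
  by apply: measurableT_comp => //; exact: measurable_fun_xsection.
have mG : measurable_fun setT (fun p : mR * mR => G p.2 : mR).
  by apply: measurableT_comp => //; exact: measurable_gauss_cdf.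
have := measurable_fun_ltr mG mq measurableT (Y := [set true]) Logic.I.
rewrite setTI (_ : _ @^-1` _ = symmetrization A)//.
have fq (p : mR * mR) : (q p)%:E = mu (xsection A p.1).
  by rewrite fineK//; apply: fin_num_measure; exact: measurable_xsection.
by apply/seteqP; split=> p; rewrite /symmetrization /= -fq lte_fin.
Qed.

Lemma mu_section01 (A : set T) : measurable A -> (0 <= mu A <= 1)%E.
Proof. by move=> mA; rewrite measure_ge0 probability_le1. Qed.

Lemma measure_symmetrization A : measurable A ->
  ((gamma \x gamma) (symmetrization A) = (gamma \x mu) A)%E.
Proof.
move=> mA; rewrite /product_measure1; apply: eq_integral => x _ /=.
rewrite xsection_symmetrization gamma_cdf_lt// mu_section01//.
exact: measurable_xsection.
Qed.

Hypothesis isoD : isoperimetric mu D.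
Hypothesis mD : forall r (A : set T), measurable (enlarge D r A).

(** Compare sections. A point (x, y) near (x', y') satisfies y <= y' + e for the radius e left over
    by the first coordinate. Isoperimetry in T for the section at x' and radius e gives G y at most
    the measure of the section of the enlarged A at x. Only this weak inequality is available, hence
    [gamma_cdf_le]. *)
Lemma symmetrization_enlarge A r : measurable A ->
  measurable (enlarge (prod_dist D) r A) ->
  measurable (enlarge (prod_dist (@sqdist R)) r (symmetrization A)) ->
  ((gamma \x gamma) (enlarge (prod_dist (@sqdist R)) r (symmetrization A)) <=
   (gamma \x mu) (enlarge (prod_dist D) r A))%E.
Proof.
move=> mA mAr msAr; apply: ge0_le_integral => //.
- exact: measurable_fun_xsection.
- exact: measurable_fun_xsection.
move=> x _ /=; rewrite -[leRHS]gamma_cdf_le; last first.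
  by apply: mu_section01; exact: measurable_xsection.
apply: le_measure; rewrite ?inE.
- exact: measurable_xsection.
- rewrite -[X in measurable X]setTI; apply: emeasurable_fun_infty_c => //.
  by apply/measurable_EFinP; exact: measurable_gauss_cdf.
move=> y; rewrite /xsection/= inE => -[[x' y'] /= sA].
rewrite /prod_dist /sqdist /= => xyr.
have mAx : measurable (xsection A x') by exact: measurable_xsection.
have [e er yye] : exists2 e, 0 < e & (x - x') ^+ 2 + e ^+ 2 <= r ^+ 2 /\ y <= y' + e.
  pose e := Num.sqrt (r ^+ 2 - (x - x') ^+ 2).
  have sq0 : 0 < r ^+ 2 - (x - x') ^+ 2 by have := sqr_ge0 (y - y'); lra.
  exists e; first by rewrite sqrtr_gt0.
  rewrite (sqr_sqrtr (ltW sq0)); split; first by lra.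
  rewrite -lerBlDl; apply: le_trans (ler_norm _) _.
  rewrite -sqrtr_sqr ler_sqrt; lra.
case: yye => xe yye.
apply: (@le_trans _ _ (G (y' + e))%:E).
  by rewrite lee_fin gauss_cdf_nondecreasing.
apply: (le_trans (isoD mAx er (ltW sA))).
apply: le_measure; rewrite ?inE//; first exact: measurable_xsection.
move=> t [a]; rewrite /xsection/= inE => Aa Dta.
by rewrite inE; exists (x', a) => //=; apply: lt_le_trans xe; rewrite ltrD2l.
Qed.

End gaussian_symmetrization.

(** * Rotation invariance *)

Section rotation_invariance.
Context (R : realType).
Local Notation mR := (measurableTypeR R).
Local Notation mu := (@lebesgue_measure R).
Local Notation gamma := (gamma R).
Local Notation phi := (@gauss_pdf R).

Lemma measurable_linear2 (a b : R) :
  measurable_fun setT (fun p : mR * mR => a * p.1 + b * p.2 : mR).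
Proof. by apply: measurable_funD; apply: measurable_funM. Qed.

Lemma measurable_linear_plane (a b c d : R) :
  measurable_fun setT
    (fun p : mR * mR => (a * p.1 + b * p.2, c * p.1 + d * p.2) : mR * mR).
Proof. by apply/measurable_fun_pair; exact: measurable_linear2. Qed.

(** For a fixed second coordinate the shear is a translation. The coefficients 1 and 0 keep it in
    the form of [measurable_linear_plane]. *)
Lemma integral_shear1 (t : R) (F : mR * mR -> \bar R) : measurable_fun setT F ->
  (forall p, 0 <= F p)%E ->
  (\int[mu \x mu]_p F (1 * p.1 + t * p.2, 0 * p.1 + 1 * p.2)%R =
   \int[mu \x mu]_p F p)%E.
Proof.
move=> mF F0; have mS := measurable_linear_plane 1 t 0 1.
have mFS := measurableT_comp mF mS.
rewrite !fubini_tonelli2//=.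
rewrite /fubini_G; apply: eq_integral => y _.
rewrite -[RHS](@ge0_integral_affine _ 1 (t * y)) ?oner_eq0 ?normr1 ?mul1e//.
- by apply: eq_integral => x _ /=; rewrite mul0r add0r !mul1r.
- exact: measurableT_comp.
Qed.

Lemma integral_shear2 (t : R) (F : mR * mR -> \bar R) : measurable_fun setT F ->
  (forall p, 0 <= F p)%E ->
  (\int[mu \x mu]_p F (1 * p.1 + 0 * p.2, t * p.1 + 1 * p.2)%R =
   \int[mu \x mu]_p F p)%E.
Proof.
move=> mF F0; have mS := measurable_linear_plane 1 0 t 1.
have mFS := measurableT_comp mF mS.
rewrite !fubini_tonelli1//=.
rewrite /fubini_F; apply: eq_integral => x _.
rewrite -[RHS](@ge0_integral_affine _ 1 (t * x)) ?oner_eq0 ?normr1 ?mul1e//.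
- by apply: eq_integral => y _ /=; rewrite mul0r addr0 !mul1r addrC.
- exact: measurableT_comp.
Qed.

Lemma gamma2E (A : set (mR * mR)) : measurable A ->
  ((gamma \x gamma) A =
   \int[mu \x mu]_p (\1_A p * (phi p.1 * phi p.2))%:E)%E.
Proof.
move=> mA.
have mphi : measurable_fun setT (fun p : mR * mR => (\1_A p * (phi p.1 * phi p.2))%:E).
  apply/measurable_EFinP; apply: measurable_funM => //.
  by apply: measurable_funM; apply: measurableT_comp => //; exact: measurable_gauss_pdf.
rewrite fubini_tonelli1//=; last first.
  by move=> p; rewrite lee_fin !mulr_ge0 ?gauss_pdf_ge0.
rewrite /product_measure1 ge0_integral_gamma//=; last exact: measurable_fun_xsection.
apply: eq_integral => x _; rewrite /fubini_F gammaE.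
rewrite muleC -ge0_integralZl//; last 4 first.
- exact: measurable_xsection.
- by apply/measurable_funTS/measurable_EFinP; exact: measurable_gauss_pdf.
- by move=> y _; rewrite lee_fin gauss_pdf_ge0.
- by rewrite lee_fin gauss_pdf_ge0.
rewrite [LHS]integral_mkcond.
apply: eq_integral => y _; rewrite patchE indicE.
rewrite (_ : (y \in xsection A x) = ((x, y) \in A)).
  by case: ifPn => _; rewrite ?mule0 ?mul0r// mul1r EFinM.
by rewrite mem_xsection.
Qed.

Lemma gauss_pdfM x y :
  phi x * phi y = normal_peak 1 ^+ 2 * expR (- ((x ^+ 2 + y ^+ 2) / 2)).
Proof.
rewrite !gauss_pdfE mulrACA -expr2 -expRD; congr (_ * expR _).
by rewrite mulrDl opprD.
Qed.

Definition rotate (c s : R) (p : mR * mR) : mR * mR :=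
  (c * p.1 + s * p.2, - s * p.1 + c * p.2).

Lemma measurable_rotate (c s : R) : measurable_fun setT (rotate c s).
Proof. exact: measurable_linear_plane. Qed.

(* A rotation is a product of three shears, which preserve Lebesgue measure. *)
Lemma gamma2_rotate (c s : R) (A : set (mR * mR)) : s != 0 ->
  c ^+ 2 + s ^+ 2 = 1 -> measurable A ->
  ((gamma \x gamma) (rotate c s @^-1` A) = (gamma \x gamma) A)%E.
Proof.
move=> s0 cs mA.
have mrA : measurable (rotate c s @^-1` A).
  by rewrite -[X in measurable X]setTI; exact: measurable_rotate.
rewrite !gamma2E//.
pose F p : \bar R := (\1_A p * (phi p.1 * phi p.2))%:E.
have mF : measurable_fun setT F.
  apply/measurable_EFinP; apply: measurable_funM => //.
  by apply: measurable_funM; apply: measurableT_comp => //; exact: measurable_gauss_pdf.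
have F0 p : (0 <= F p)%E by rewrite lee_fin !mulr_ge0 ?gauss_pdf_ge0.
transitivity (\int[mu \x mu]_p F (rotate c s p))%E.
  apply: eq_integral => p _; rewrite /F !gauss_pdfM.
  suff -> : (rotate c s p).1 ^+ 2 + (rotate c s p).2 ^+ 2 = p.1 ^+ 2 + p.2 ^+ 2 by [].
  by rewrite /rotate/= -[RHS]mul1r -cs; ring.
(* The product of the shears with parameters a, - s, a is the rotation as soon as 1 - a s = c and a
   (1 + c) = s; the first equation determines a and the second follows from c ^ 2 + s ^ 2 = 1. *)
pose a := (1 - c) / s.
pose F1 (p : mR * mR) := F (1 * p.1 + a * p.2, 0 * p.1 + 1 * p.2).
pose F2 (p : mR * mR) := F1 (1 * p.1 + 0 * p.2, - s * p.1 + 1 * p.2).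
have mF1 : measurable_fun setT F1.
  by apply: (measurableT_comp mF); exact: measurable_linear_plane.
have mF2 : measurable_fun setT F2.
  by apply: (measurableT_comp mF1); exact: measurable_linear_plane.
transitivity (\int[mu \x mu]_p F1 p)%E; last exact: integral_shear1.
transitivity (\int[mu \x mu]_p F2 p)%E; last by apply: integral_shear2 => // p; exact: F0.
rewrite -(integral_shear1 a mF2); last by move=> p; exact: F0.
apply: eq_integral => p _; congr F; rewrite /rotate/=.
have as_ : a * s = 1 - c by rewrite divfK.
have aac : a * (1 + c) = s.
  apply: (mulIf s0); rewrite mulrAC as_; transitivity (1 - c ^+ 2); first by ring.
  by rewrite -cs; ring.
congr pair.
  transitivity ((1 - a * s) * p.1 + (a * (1 + (1 - a * s))) * p.2).
    by rewrite as_ subKr aac.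
  by ring.
transitivity (- s * p.1 + (1 - a * s) * p.2); first by rewrite as_ subKr.
by ring.
Qed.

End rotation_invariance.

(** * Measurability of enlargements *)

Section measurable_enlarge.
Context (R : realType).
Local Notation mR := (measurableTypeR R).

Definition tuple_dist n (s t : n.-tuple mR) : R :=
  \sum_i (tnth s i - tnth t i) ^+ 2.

Lemma open_sqdist_row n (a : 'I_n -> R) (r : R) :
  open [set v : 'rV[R]_n | \sum_i (v ord0 i - a i) ^+ 2 < r].
Proof.
pose f (v : 'rV[R]_n) : R := \sum_i (v ord0 i - a i) ^+ 2.
have cf : continuous f.
  apply: continuous_big => [|i _]; first exact: add_continuous.
  have c1 : continuous (fun v : 'rV[R]_n => v ord0 i) by exact: coord_continuous.
  have c2 : continuous (fun v : 'rV[R]_n => v ord0 i - a i).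
    move=> v; exact: (cvgB (c1 v) (cvg_cst (a i))).
  move=> v; apply: (@continuous_comp _ _ _ (fun v : 'rV[R]_n => v ord0 i - a i)
    (fun x => x ^+ 2)); [exact: c2|exact: exprn_continuous].
by apply: (@open_comp _ _ f [set x | x < r]) => [v _|]; [exact: cf|exact: open_lt].
Qed.

(** An enlargement is a union of open balls. The open set is formed among row vectors, whose
    topology is at hand, and pulled back to the product sigma-algebra of tuples. *)
Lemma measurable_enlarge_tuple n r (A : set (n.-tuple mR)) :
  measurable (enlarge (@tuple_dist n) r A).
Proof.
pose U := \bigcup_(a in A)
  [set v : 'rV[R]_n | \sum_i (v ord0 i - tnth a i) ^+ 2 < r ^+ 2].
have oU : open U by apply: bigcup_open => a _; exact: open_sqdist_row.
rewrite (_ : enlarge _ _ _ = @row_tuple R n @^-1` U).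
  rewrite -[X in measurable X]setTI; apply: measurable_row_tuple => //.
  exact: sub_sigma_algebra.
have tE t a : tuple_dist t a = \sum_i (row_tuple t ord0 i - tnth a i) ^+ 2.
  by apply: eq_bigr => i _; rewrite mxE.
by apply/seteqP; split=> t [a Aa ta]; exists a => //=; rewrite -?tE// tE.
Qed.

Lemma tuple_dist_cons n (p q : mR * n.-tuple mR) :
  tuple_dist (Defs.cons_tuple p) (Defs.cons_tuple q) = prod_dist (@tuple_dist n) p q.
Proof.
rewrite /tuple_dist big_ord_recl /prod_dist; congr (_ + _).
by apply: eq_bigr => i _; rewrite !tnthS.
Qed.

Lemma measurable_enlarge_cons n r (A : set (mR * n.-tuple mR)) :
  measurable (enlarge (prod_dist (@tuple_dist n)) r A).
Proof.
rewrite (_ : enlarge _ _ _ =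
    @Defs.cons_tuple R n @^-1`
      (enlarge (@tuple_dist n.+1) r (@Defs.cons_tuple R n @` A))).
  rewrite -[X in measurable X]setTI; apply: measurable_cons_tuple => //.
  exact: measurable_enlarge_tuple.
apply/seteqP; split=> [p [a Aa pa]|p [_ [a Aa <-]]].
  by exists (Defs.cons_tuple a); [exists a|rewrite tuple_dist_cons].
by rewrite tuple_dist_cons; exists a.
Qed.

(** The plane is embedded isometrically in the product of the line and the 1-tuples. *)
Lemma measurable_enlarge_plane r (A : set (mR * mR)) :
  measurable (enlarge (prod_dist (@sqdist R)) r A).
Proof.
pose f (p : mR * mR) : mR * 1.-tuple mR := (p.1, Defs.cons_tuple (p.2, [tuple])).
have mf : measurable_fun setT f.
  apply/measurable_fun_pair => //=.
  apply: (measurableT_comp (@measurable_cons_tuple R 0)).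
  exact/measurable_fun_pair.
have fD p q : prod_dist (@tuple_dist 1) (f p) (f q) = prod_dist (@sqdist R) p q.
  rewrite /prod_dist /=; congr (_ + _).
  by rewrite tuple_dist_cons /prod_dist /tuple_dist big_ord0 addr0.
rewrite (_ : enlarge _ _ _ = f @^-1` (enlarge (prod_dist (@tuple_dist 1)) r (f @` A))).
  rewrite -[X in measurable X]setTI; apply: mf => //.
  exact: measurable_enlarge_cons.
apply/seteqP; split=> [p [a Aa pa]|p [_ [a Aa <-]]].
  by exists (f a); [exists a|rewrite fD].
by rewrite fD; exists a.
Qed.

End measurable_enlarge.

(** * Isoperimetry in the plane *)

Section isoperimetry_plane.
Context (R : realType).
Local Notation mR := (measurableTypeR R).
Local Notation gamma := (gamma R).
Local Notation gamma2 := (gamma \x gamma)%E.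
Local Notation G := (@gauss_cdf R).
Local Notation enl := (enlarge (prod_dist (@sqdist R))).
Local Notation sym := (@symmetrization R _ mR gamma).

(** The cone has its axis along the positive first coordinate and half-angle arctan k: a ray for k =
    0, nearly a half-plane for large k. *)
Definition cone_invariant (k : R) (A : set (mR * mR)) := forall x y s t,
  A (x, y) -> 0 <= s -> `|t| <= k * s -> A (x + s, y + t).

Let isoR := @isoperimetric_line R.
Let mline r A : measurable (enlarge (@sqdist R) r A) := @measurable_enlarge_line R r A.

Lemma enlarge_rotate (c s r : R) (A : set (mR * mR)) : c ^+ 2 + s ^+ 2 = 1 ->
  enl r (rotate c s @^-1` A) `<=` rotate c s @^-1` (enl r A).
Proof.
move=> cs p [q Aq pq]; exists (rotate c s q) => //.
rewrite (_ : prod_dist _ _ _ = prod_dist (@sqdist R) p q)//.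
rewrite /prod_dist /sqdist /rotate/= -[RHS]mul1r -cs; ring.
Qed.

Lemma symmetrize_rotate (c s r : R) (A : set (mR * mR)) : s != 0 ->
  c ^+ 2 + s ^+ 2 = 1 -> measurable A ->
  [/\ measurable (rotate c s @^-1` sym A),
      gamma2 (rotate c s @^-1` sym A) = gamma2 A &
      (gamma2 (enl r (rotate c s @^-1` sym A)) <= gamma2 (enl r A))%E].
Proof.
move=> s0 cs mA.
have msA := @measurable_symmetrization R _ mR gamma A mA.
have mr B : measurable B -> measurable (rotate c s @^-1` B).
  by move=> mB; rewrite -[X in measurable X]setTI; exact: measurable_rotate.
split; first exact: mr.
  by rewrite (gamma2_rotate s0 cs msA); exact: measure_symmetrization.
apply: le_trans (symmetrization_enlarge isoR mline mA _ _); last 2 first.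
  exact: measurable_enlarge_plane.
  exact: measurable_enlarge_plane.
rewrite -[leRHS](gamma2_rotate s0 cs); last exact: measurable_enlarge_plane.
apply: le_measure; rewrite ?inE; last exact: enlarge_rotate.
  exact: measurable_enlarge_plane.
by apply: mr; exact: measurable_enlarge_plane.
Qed.

Lemma symmetrization_down (A : set (mR * mR)) x y t :
  sym A (x, y) -> 0 <= t -> sym A (x, y - t).
Proof.
move=> sA t0; apply: le_lt_trans sA; rewrite lee_fin gauss_cdf_nondecreasing//.
by rewrite gerBl.
Qed.

(** Cone invariance places the enlargement by k s of the section at x inside the section at x + s;
    isoperimetry on the line turns this into a rise of k s. *)
Lemma symmetrization_cone (A : set (mR * mR)) k x y s : measurable A -> 0 <= k ->
  cone_invariant k A -> sym A (x, y) -> 0 <= s -> sym A (x + s, y + k * s).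
Proof.
move=> mA k0 kA; rewrite /symmetrization/= => sA s0.
have mAx z : measurable (xsection A z) by exact: measurable_xsection.
have [ks0|ks0] := eqVneq (k * s) 0.
  rewrite ks0 addr0; apply: lt_le_trans sA _; apply: le_measure; rewrite ?inE//.
  move=> t /xsectionP At; apply/xsectionP; rewrite -[t]addr0.
  by apply: kA => //; rewrite normr0 ks0.
have {}ks0 : 0 < k * s by rewrite lt_neqAle eq_sym ks0 mulr_ge0.
have fx : gamma (xsection A x) \is a fin_num by exact: gamma_fin.
move: sA; rewrite -(fineK fx) lte_fin; set p := fine _ => yp.
have p1 : p <= 1 by rewrite -lee_fin fineK// probability_le1.
(* Isoperimetry yields a weak bound; starting from y' strictly above y makes the final one
   strict. *)
have [|y' y'E] := @gauss_cdf_onto R ((G y + p) / 2).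
  by have Gy := gauss_cdf_gt0 y; apply/andP; split; lra.
have yy' : y < y' by rewrite -ltr_gauss_cdf y'E; lra.
apply: (@lt_le_trans _ _ (G (y' + k * s))%:E).
  by rewrite lte_fin ltr_gauss_cdf ltrD2r.
apply: le_trans (isoR (mAx x) ks0 _) _.
  by rewrite -(fineK fx) lee_fin y'E -/p; lra.
apply: le_measure; rewrite ?inE//; first exact: mline.
move=> t [a /xsectionP Aa]; rewrite /sqdist => ta; apply/xsectionP.
rewrite -[t](subrK a) [t - a + a]addrC; apply: kA => //.
rewrite -ler_sqr ?nnegrE ?normr_ge0 ?(ltW ks0)//.
by rewrite real_normK ?num_real// ltW.
Qed.

(* A cone of half-angle [arctan k] is widened by one step to half-angle
   [pi / 4 + arctan k / 2], whose tangent is [k + sqrt (1 + k ^ 2)]. *)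
Lemma widen_cone (k r : R) (A : set (mR * mR)) : 0 <= k -> measurable A ->
  cone_invariant k A -> exists k' B,
  [/\ k + 1 <= k', measurable B, cone_invariant k' B, gamma2 B = gamma2 A &
      (gamma2 (enl r B) <= gamma2 (enl r A))%E].
Proof.
move=> k0 mA kA.
pose q := Num.sqrt (1 + k ^+ 2).
have q2 : q ^+ 2 = 1 + k ^+ 2 by rewrite sqr_sqrtr// addr_ge0// sqr_ge0.
have q1 : 1 <= q.
  by rewrite -[leLHS]sqrtr1 ler_sqrt ?lerDl ?sqr_ge0// ltW// ltr_pwDl ?sqr_ge0.
pose k' := k + q.
have k'2 : k' ^+ 2 = 1 + 2 * k * k'.
  rewrite /k'; transitivity (k ^+ 2 + 2 * k * q + q ^+ 2); first by ring.
  by rewrite q2; ring.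
pose N := Num.sqrt (1 + k' ^+ 2).
have N0 : 0 < N by rewrite sqrtr_gt0 ltr_pwDl ?sqr_ge0.
have N2 : N ^+ 2 = 1 + k' ^+ 2 by rewrite sqr_sqrtr// addr_ge0// sqr_ge0.
have cs : (k' / N) ^+ 2 + (N^-1) ^+ 2 = 1.
  rewrite expr_div_n exprVn -[X in _ + X]mul1r -mulrDl addrC -N2 divff//.
  by rewrite expf_eq0/= gt_eqF.
have s0 : N^-1 != 0 by rewrite invr_eq0 gt_eqF.
(* The symmetrized set is stable in the directions (1, k) and (0, - 1). This rotation sends the
   first axis to their bisector, the direction of (k', - 1). *)
suff kB : cone_invariant k' (rotate (k' / N) N^-1 @^-1` sym A).
  have [mB BE Ble] := @symmetrize_rotate (k' / N) N^-1 r A s0 cs mA.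
  exists k', (rotate (k' / N) N^-1 @^-1` sym A).
  by split; [rewrite lerD2l|exact: mB|exact: kB|exact: BE|exact: Ble].
move=> x y s t; rewrite /rotate/= => sA ss tk.
(* The rotated displacement of (s, t) is a (1, k) + b (0, - 1). The lower bound on t makes a
   nonnegative, the upper bound does so for b. *)
pose a := (s * k' + t) / N.
pose b := (s * (1 + k * k') - t * (k' - k)) / N.
move: tk; rewrite ler_norml => /andP[tk1 tk2].
have a0 : 0 <= a by rewrite divr_ge0 ?(ltW N0)//; lra.
have k'k : 0 <= k' - k by rewrite /k'; lra.
have b0 : 0 <= b.
  rewrite divr_ge0 ?(ltW N0)// subr_ge0.
  apply: (le_trans (ler_wpM2r k'k tk2)).
  rewrite (_ : k' * s * (k' - k) = s * (k' ^+ 2 - k * k')); last by ring.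
  by rewrite k'2 (_ : 1 + 2 * k * k' - k * k' = 1 + k * k')//; ring.
have := symmetrization_down (symmetrization_cone mA k0 kA sA a0) b0.
congr (sym A (_, _)).
  by rewrite /a; ring.
by rewrite /a /b; ring.
Qed.

(** Start of the iteration: a symmetrized set is stable downwards, and the quarter turn makes this
    direction the axis of the cone. *)
Lemma quarter_turn (r : R) (A : set (mR * mR)) : measurable A -> exists B,
  [/\ measurable B, cone_invariant 0 B, gamma2 B = gamma2 A &
      (gamma2 (enl r B) <= gamma2 (enl r A))%E].
Proof.
move=> mA; have cs : 0 ^+ 2 + 1 ^+ 2 = 1 :> R by rewrite expr0n expr1n add0r.
have [mB BE Ble] := @symmetrize_rotate 0 1 r A (oner_neq0 _) cs mA.
exists (rotate 0 1 @^-1` sym A); split; [exact: mB| |exact: BE|exact: Ble].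
move=> x y s t sA s0.
rewrite mul0r normr_le0 => /eqP->; move: sA; rewrite /rotate/= !mul0r !add0r !addr0 => sA.
have := symmetrization_down sA s0; congr (sym A (_, _)); ring.
Qed.

Lemma wide_cone (n : nat) (r : R) (A : set (mR * mR)) : measurable A ->
  exists k B,
  [/\ n%:R <= k, measurable B, cone_invariant k B, gamma2 B = gamma2 A &
      (gamma2 (enl r B) <= gamma2 (enl r A))%E].
Proof.
move=> mA; elim: n => [|n [k [B [nk mB kB BE Ble]]]].
  by have [B [mB kB BE Ble]] := quarter_turn r mA; exists 0, B; split.
have [|k' [B' [kk' mB' kB' BE' Ble']]] := @widen_cone k r B _ mB kB.
  exact: le_trans nk.
exists k', B'; split.
- by rewrite -natr1; apply: le_trans kk'; rewrite lerD2r; exact: nk.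
- exact: mB'.
- exact: kB'.
- by rewrite BE'; exact: BE.
- exact: le_trans Ble' Ble.
Qed.

Let gamma2X (A B : set mR) : measurable A -> measurable B ->
  (gamma2 (A `*` B) = gamma A * gamma B)%E.
Proof. exact: product_measure1E. Qed.

Lemma gamma_tail (L : R) : 0 <= L ->
  gamma [set y | L < `|y|] = (2 * (1 - G L))%:E.
Proof.
move=> L0; rewrite (_ : [set _ | _] = `]-oo, (- L)[%classic `|` `]L, +oo[%classic).
  rewrite measureU//=; last first.
    by apply/seteqP; split=> // x []/=; rewrite !in_itv/=; lra.
  by rewrite gamma_Nyo gamma_oy gauss_cdfN -EFinD; congr (_%:E); ring.
apply/seteqP; split=> x /=; rewrite !in_itv/= andbT ltr_normr ltrNr.
  by move=> /orP[|]; [right|left].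
by move=> [->|->]; rewrite ?orbT.
Qed.

Let mtail (L : R) : measurable [set y : mR | L < `|y|].
Proof.
have := @open_measurable R [set y : R | L < `|y|]; apply.
apply: (@open_comp _ _ (fun y : R => `|y|) [set x | L < x]); last exact: open_gt.
by move=> y _; exact: norm_continuous.
Qed.

(* Off the tail [L < `|y|], a set invariant under a wide cone either contains or
   is contained in a half-plane bounded near [x = - c]. *)
Lemma isoperimetric_cone (k c r d L : R) (A : set (mR * mR)) :
  0 < k -> 0 < r -> 0 < d -> 0 < L -> L / k <= d / 2 ->
  2 * (1 - G L) < G c - G (c - d / 2) ->
  measurable A -> cone_invariant k A -> ((G c)%:E <= gamma2 A)%E ->
  ((G (c + r - 2 * d) - 2 * (1 - G L))%:E <= gamma2 (enl r A))%E.
Proof.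
move=> k0 r0 d0 L0 Lk Ltail mA kA GA.
(* The half-plane x > - c has measure G c. The test point lies d inside its edge, so that a set
   missing it will turn out to be too small. *)
pose x0 : R := - c + d.
have [Ao|nAo] := pselect (A (x0, 0)).
  pose B : set (mR * mR) := `]x0 - r + d, +oo[%classic `*` ~` [set y | L < `|y|].
  have mB : measurable B by apply: measurableX => //; exact: measurableC.
  apply: (@le_trans _ _ (gamma2 B)).
    rewrite gamma2X//; last exact: measurableC.
    rewrite probability_setC// gamma_tail ?(ltW L0)// gamma_oy -(gauss_cdfN (x0 - r + d)).
    rewrite -EFinB -EFinM lee_fin.
    have -> : - (x0 - r + d) = c + r - 2 * d by rewrite /x0; ring.
    have g0 := gauss_cdf_ge0 (c + r - 2 * d).
    have g1 := gauss_cdf_lt1 (c + r - 2 * d).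
    have h1 := gauss_cdf_lt1 L.
    have : G (c + r - 2 * d) * (2 * (1 - G L)) <= 1 * (2 * (1 - G L)).
      by rewrite ler_wpM2r ?(ltW g1)//; lra.
    lra.
  apply: le_measure; rewrite ?inE//; first exact: measurable_enlarge_plane.
  move=> [x y] [/=]; rewrite in_itv/= andbT => ox /negP; rewrite -leNgt => yL.
  have yk : `|y| <= k * (d / 2).
    by apply: (le_trans yL); rewrite mulrC -ler_pdivrMr.
  (* A move to the right by r - e / 2 is shorter than r and passes x0 + d / 2, beyond which the cone
     at (x0, 0) has height at least L. *)
  pose e := Num.min r (d / 2).
  have e0 : 0 < e by rewrite lt_min r0 divr_gt0.
  have er : e <= r by rewrite ge_min lexx.
  have ed : e <= d / 2 by rewrite ge_min lexx orbT.
  exists (x + (r - e / 2), y).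
    have := kA x0 0 (x + (r - e / 2) - x0) y Ao.
    rewrite add0r [x0 + _]addrC subrK => H; apply: H; first by lra.
    by apply: (le_trans yk); rewrite ler_wpM2l ?(ltW k0)//; lra.
  rewrite /prod_dist /sqdist/= subrr expr0n addr0 opprD addNKr sqrrN.
  by rewrite ltr_sqr ?nnegrE; lra.
(* A point of A with x < x0 - d / 2 and height at most L would have (x0, 0) in its cone. Hence A is
   confined to B, whose measure is below G c. *)
exfalso; pose B : set (mR * mR) :=
  (`[x0 - d / 2, +oo[%classic `*` setT) `|` (setT `*` [set y | L < `|y|]).
have mB1 : measurable ((`[x0 - d / 2, +oo[%classic `*` setT) : set (mR * mR)).
  exact: measurableX.
have mB2 : measurable ((setT `*` [set y | L < `|y|]) : set (mR * mR)).
  exact: measurableX.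
have AB : A `<=` B.
  move=> [x y] Axy; have [Ly|yL] := ltP L `|y|; first by right.
  left; split => //=; rewrite in_itv/= andbT leNgt; apply/negP => xo.
  apply: nAo; have := kA x y (x0 - x) (- y) Axy.
  rewrite subrKC subrr => H; apply: H; first by lra.
  rewrite normrN; apply: (le_trans yL).
  apply: (@le_trans _ _ (k * (d / 2))); first by rewrite mulrC -ler_pdivrMr.
  by rewrite ler_wpM2l ?(ltW k0)//; lra.
have : (gamma2 A <= (G (c - d / 2))%:E + (2 * (1 - G L))%:E)%E.
  apply: (@le_trans _ _ (gamma2 B)).
    by apply: le_measure; rewrite ?inE//; exact: measurableU.
  have -> : (G (c - d / 2))%:E = gamma2 (`[x0 - d / 2, +oo[%classic `*` setT).
    rewrite gamma2X// probability_setT mule1 -setCitvl probability_setC//.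
    rewrite gamma_Nyo -EFinB -(gauss_cdfN (x0 - d / 2)); congr (G _)%:E.
    by rewrite /x0; field.
  have -> : (2 * (1 - G L))%:E = gamma2 (setT `*` [set y | L < `|y|]).
    by rewrite gamma2X// probability_setT mul1e gamma_tail// ltW.
  exact: measureU2.
move=> /(le_trans GA); rewrite -EFinD lee_fin; lra.
Qed.

Theorem isoperimetric_plane (A : set (mR * mR)) (c r : R) :
  measurable A -> 0 < r ->
  ((G c)%:E <= gamma2 A -> (G (c + r))%:E <= gamma2 (enl r A))%E.
Proof.
move=> mA r0 GA; apply: gauss_cdf_le_left => y ycr.
pose d := (c + r - y) / 2; have d0 : 0 < d by rewrite divr_gt0//; lra.
have -> : y = c + r - 2 * d by rewrite /d; field.
apply/lee_addgt0Pr => e e0.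
(* The tails must stay below both the allowed error e and the gap required by [isoperimetric_cone].
   This fixes L, and then n is chosen so that slopes from n on give L / k <= d / 2. *)
pose t := Num.min e ((G c - G (c - d / 2)) / 2).
have Gd : G (c - d / 2) < G c by rewrite ltr_gauss_cdf; lra.
have t0 : 0 < t by rewrite lt_min e0 divr_gt0//; lra.
have te : t <= e by rewrite ge_min lexx.
have tG : t <= (G c - G (c - d / 2)) / 2 by rewrite ge_min lexx orbT.
have t20 : 0 < t / 2 by rewrite divr_gt0.
have [L0 GL0] := gauss_cdf_near1 t20.
pose L := `|L0| + 1.
have LL : L0 <= L by rewrite /L; have := ler_norm L0; lra.
have L_gt0 : 0 < L by rewrite /L; have := normr_ge0 L0; lra.
have GL : 2 * (1 - G L) < t by have := gauss_cdf_nondecreasing LL; lra.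
pose n := Num.bound (L / (d / 2)).
have d20 : 0 < d / 2 by exact: divr_gt0.
have m0 : 0 < L / (d / 2) by exact: divr_gt0.
have Ln : L / (d / 2) < n%:R by exact/archi_boundP/ltW.
have tail : 2 * (1 - G L) < G c - G (c - d / 2) by lra.
have kL k : n%:R <= k -> 0 < k /\ L / k <= d / 2.
  move=> nk; have k0 : 0 < k by apply: lt_le_trans nk; exact: lt_trans Ln.
  split=> //; rewrite (ler_pdivrMr _ _ k0) mulrC -(ler_pdivrMr _ _ d20).
  exact/ltW/(lt_le_trans Ln).
have [k [B [/kL[k0 Lk] mB kB BE Ble]]] := wide_cone n r mA.
have GB : ((G c)%:E <= gamma2 B)%E by rewrite BE.
have H := isoperimetric_cone k0 r0 d0 L_gt0 Lk tail mB kB GB.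
have {H GB Ble BE kB mB GA} := le_trans H Ble.
move: (gamma2 (enl r A)) => q Hq; apply: (le_trans _ (leeD2r e%:E Hq)).
by rewrite -EFinD lee_fin; lra.
Qed.

End isoperimetry_plane.

(** * Isoperimetry in dimension n *)

Section isoperimetry_gaussian.
Context (R : realType).
Local Notation mR := (measurableTypeR R).
Local Notation gamma := (gamma R).
Local Notation G := (@gauss_cdf R).

(** The induction starts at the one-point space; line and plane enter only in the step, where the
    induction hypothesis is the fibre inequality of [symmetrization_enlarge]. *)
Theorem isoperimetric_tuple n :
  isoperimetric (gaussian_tuple R n) (@tuple_dist R n).
Proof.
elim: n => [|n IH] A c r mA r0 GA.
  have A0 : A [tuple].
    apply: contrapT => nA; move: GA.
    by rewrite /= diracE memNset// leNgt lte_fin gauss_cdf_gt0.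
  rewrite /= diracE mem_set ?lee_fin ?ltW ?gauss_cdf_lt1//.
  by exists [tuple] => //; rewrite /tuple_dist big_ord0 exprn_gt0.
pose B := @Defs.cons_tuple R n @^-1` A.
have mB : measurable B.
  by rewrite -[X in measurable X]setTI; exact: measurable_cons_tuple.
have mEr C : measurable (enlarge (@tuple_dist R n) r C).
  exact: measurable_enlarge_tuple.
have GB : ((G c)%:E <= (gamma \x gamma)%E (symmetrization (gaussian_tuple R n) B))%E.
  by rewrite (measure_symmetrization (gaussian_tuple R n) mB).
have msB := measurable_symmetrization (gaussian_tuple R n) mB.
apply: le_trans (isoperimetric_plane msB r0 GB) _.
apply: le_trans (symmetrization_enlarge IH _ mB _ _) _.
- exact: measurable_enlarge_tuple.
- exact: measurable_enlarge_cons.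
- exact: measurable_enlarge_plane.
rewrite /= /distribution /pushforward; apply: le_measure; rewrite ?inE.
- exact: measurable_enlarge_cons.
- rewrite -[X in measurable X]setTI; apply: measurable_cons_tuple => //.
  exact: measurable_enlarge_tuple.
move=> p [q Bq pq]; exists (Defs.cons_tuple q) => //.
by rewrite tuple_dist_cons.
Qed.

Definition row_dist n (v w : 'rV[R]_n) : R := \sum_i (v ord0 i - w ord0 i) ^+ 2.

Lemma open_enlarge_row n r (A : set 'rV[R]_n) : open (enlarge (@row_dist n) r A).
Proof.
rewrite (_ : enlarge _ _ _ = \bigcup_(a in A)
    [set v : 'rV[R]_n | \sum_i (v ord0 i - a ord0 i) ^+ 2 < r ^+ 2]).
  by apply: bigcup_open => a _; exact: open_sqdist_row.
by apply/seteqP; split=> v [a Aa va]; exists a.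
Qed.

Lemma open_measurable_row n (U : set 'rV[R]_n) : open U -> measurable U.
Proof. by move=> oU; exact: sub_sigma_algebra. Qed.

Theorem isoperimetric_row n : isoperimetric (gaussian R n) (@row_dist n).
Proof.
move=> A c r mA r0; rewrite /= /distribution /pushforward => GA.
have mA' : measurable (@row_tuple R n @^-1` A).
  by rewrite -[X in measurable X]setTI; exact: measurable_row_tuple.
apply: le_trans (isoperimetric_tuple mA' r0 GA) _.
apply: le_measure; rewrite ?inE.
- exact: measurable_enlarge_tuple.
- rewrite -[X in measurable X]setTI; apply: measurable_row_tuple => //.
  by apply: open_measurable_row; exact: open_enlarge_row.
move=> t [s As ts]; exists (row_tuple s) => //.
by rewrite /row_dist; under eq_bigr do rewrite !mxE.
Qed.

End isoperimetry_gaussian.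

(** * Level sets and completed integrals *)

Section layer_cake.
Context (R : realType) (disp : measure_display) (T : measurableType disp).
Local Notation mR := (measurableTypeR R).
Local Notation lambda := (@lebesgue_measure R).
Local Open Scope ereal_scope.

Lemma measurable_superlevel (h : T -> \bar R) :
  (forall r : R, measurable [set x | r%:E < h x]) -> measurable_fun setT h.
Proof.
move=> mh; apply: (measurability _ (ErealGenOInfty.measurableE R)) => //.
by move=> _ [_ [r ->] <-]; rewrite setTI; rewrite preimage_itvoy; exact: mh.
Qed.

Lemma lebesgue_measure_layer (y : \bar R) : 0 <= y ->
  lambda [set r | (0 < r)%R /\ r%:E < y] = y.
Proof.
case: y => [y||]//.
- rewrite lee_fin => y0; rewrite (_ : [set _ | _] = `]0%R, y[%classic).
    rewrite lebesgue_measure_itv/= lte_fin.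
    by case: ltP => [|y0']; rewrite ?oppr0 ?adde0//;
      congr (_%:E); apply/eqP; rewrite eq_le y0 y0'.
  apply/seteqP; split=> r /=; rewrite in_itv/= lte_fin; first by move=> [-> ->].
  by move=> /andP[].
- rewrite (_ : [set _ | _] = `]0%R, +oo[%classic).
    by rewrite lebesgue_measure_itv/= ltry.
  apply/seteqP; split=> r /=; rewrite in_itv/= andbT ltry; first by case.
  by [].
Qed.

(** Tonelli for the indicator of the region S under the graph. *)
Lemma ge0_layer_cake (mu : {sigma_finite_measure set T -> \bar R}) (h : T -> \bar R) :
  measurable_fun setT h -> (forall x, 0 <= h x) ->
  \int[mu]_x h x = \int[lambda]_(r in `]0%R, +oo[) mu [set x | r%:E < h x].
Proof.
move=> mh h0.
pose S : set (T * mR) := [set p | (0 < p.2)%R /\ p.2%:E < h p.1].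
have mS : measurable S.
  have mh1 : measurable_fun setT (fun p : T * mR => h p.1 - p.2%:E).
    apply: emeasurable_funB; first exact: measurableT_comp.
    exact/measurable_EFinP.
  have -> : S = (setT `*` `]0%R, +oo[%classic) `&`
      (setT `&` [set p | 0 < h p.1 - p.2%:E]).
    apply/seteqP; split=> p /=; rewrite in_itv/= andbT.
      by move=> [p0 hp]; do ![split] => //; rewrite EFinN sube_gt0.
    by move=> [[_ p0] [_]]; rewrite EFinN sube_gt0.
  by apply: measurableI; [exact: measurableX|exact: emeasurable_fun_o_infty].
pose F (p : T * mR) : \bar R := (\1_S p)%:E.
have mF : measurable_fun setT F by exact/measurable_EFinP/measurable_indic.
have F0 p : 0 <= F p by rewrite lee_fin.
transitivity (\int[mu]_x \int[lambda]_r F (x, r)).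
  apply: eq_integral => x _.
  rewrite -[LHS]lebesgue_measure_layer//; set B := [set r | _].
  have mB : measurable B.
    rewrite (_ : B = xsection S x); first exact: measurable_xsection.
    by apply/seteqP; split=> r; rewrite /xsection/= inE.
  by rewrite -[B]setIT -integral_indic//; apply: eq_integral => r _.
rewrite (fubini_tonelli _ mF F0) [RHS]integral_mkcond; apply: eq_integral => r _.
have [r0|r0] := ltP 0%R r.
  rewrite patchE mem_set; last by rewrite /= in_itv/= r0.
  set B := [set x | r%:E < h x].
  have mB : measurable B.
    rewrite (_ : B = ysection S r); first exact: measurable_ysection.
    by apply/seteqP; split=> x; rewrite /ysection/= inE /S/=; [|case].
  rewrite -[B]setIT -integral_indic//; apply: eq_integral => x _.
  rewrite /F !indicE (_ : ((x, r) \in S) = (x \in B))//.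
  by apply/idP/idP; rewrite !inE /S/=; [case|].
rewrite patchE memNset; last by rewrite /= in_itv/= andbT; apply/negP; rewrite -leNgt.
apply: integral0_eq => x _; rewrite /F indicE memNset// => -[/= r0' _].
by move: (lt_le_trans r0' r0); rewrite ltxx.
Qed.

Lemma measure_superlevel_measurable (mu : {sigma_finite_measure set T -> \bar R})
    (h : T -> \bar R) (D : set R) : measurable_fun setT h ->
  measurable_fun D (fun r : mR => mu [set x | r%:E < h x]).
Proof.
move=> mh; apply/measurable_funTS.
have mS : measurable [set p : T * mR | p.2%:E < h p.1].
  have mh1 : measurable_fun setT (fun p : T * mR => h p.1 - p.2%:E).
    apply: emeasurable_funB; first exact: measurableT_comp.
    exact/measurable_EFinP.
  rewrite (_ : [set _ | _] = setT `&` [set p | 0 < h p.1 - p.2%:E]).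
    exact: emeasurable_fun_o_infty.
  by apply/seteqP; split=> p /=; rewrite EFinN sube_gt0; [|case].
have := measurable_fun_ysection mu mS; apply: eq_measurable_fun => r _ /=.
by congr (mu _); apply/seteqP; split=> x /=; rewrite /ysection/= inE.
Qed.

End layer_cake.

(** Compares integrals over different spaces through the common level r; it serves the first
    inequality and, in both directions, the equality of norms. *)
Lemma ge0_le_integral_superlevel (R : realType) (d1 d2 : measure_display)
    (T1 : measurableType d1) (T2 : measurableType d2)
    (m1 : {sigma_finite_measure set T1 -> \bar R})
    (m2 : {sigma_finite_measure set T2 -> \bar R})
    (h1 : T1 -> \bar R) (h2 : T2 -> \bar R) :
  measurable_fun setT h1 -> (forall x, 0 <= h1 x)%E ->
  measurable_fun setT h2 -> (forall x, 0 <= h2 x)%E ->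
  (forall r, 0 < r ->
    (m1 [set x | (r%:E < h1 x)%E] <= m2 [set x | (r%:E < h2 x)%E])%E) ->
  (\int[m1]_x h1 x <= \int[m2]_x h2 x)%E.
Proof.
move=> mh1 h10 mh2 h20 h12; rewrite !ge0_layer_cake//.
apply: ge0_le_integral => //; try exact: measure_superlevel_measurable.
by move=> r /=; rewrite in_itv/= andbT; exact: h12.
Qed.

Section completed.
Context (R : realType) (disp : measure_display) (T : measurableType disp).
Variable P : probability T R.

(** The identity is measurable from the Caratheodory sigma-algebra to the original one and pushes
    the extension forward to P. *)
Lemma completed_integralE (h : T -> \bar R) : measurable_fun setT h ->
  (forall x, 0 <= h x)%E -> (completed_integral P h = \int[P]_x h x)%E.
Proof.
move=> mh h0; rewrite /completed_integral.
pose C := caratheodory_type (P^*)%mu.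
have mid : @measurable_fun _ _ C T setT id.
  move=> _ A mA; rewrite setTI; exact: caratheodory_measurable_mu_ext.
have h0' : {in [set: T], forall y, (0 <= h y)%E} by move=> x _; exact: h0.
have := ge0_integral_pushforward mid (@completed_measure_extension _ _ _ P)
  measurableT mh h0'.
rewrite preimage_setT => <-.
apply: eq_measure_integral => A mA _.
exact: measurable_mu_extE.
Qed.

Lemma completed_normE (p : R) (h : T -> \bar R) :
  measurable_fun setT h -> (forall x, 0 <= h x)%E ->
  (completed_norm P p h = (\int[P]_x (h x `^ p)) `^ p^-1)%E.
Proof.
move=> mh h0; rewrite /completed_norm unlock/=; congr (_ `^ _)%E.
under eq_integral do rewrite gee0_abs//.
rewrite -completed_integralE//; last by move=> x; exact: poweR_ge0.
exact: (measurableT_comp (measurable_poweR _)).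
Qed.

End completed.

(** * The rearrangement *)

Section rearrangement_theory.
Context (R : realType) (n : nat).
Local Notation mR := (measurableTypeR R).
Local Notation gamma := (gamma R).
Local Notation G := (@gauss_cdf R).
Local Notation P := (gaussian R n).

(** Eliminates [Phi_inv]: its conventions at 0 and 1 fit the strict inequality because G lies
    strictly between 0 and 1. *)
Lemma half_lineE (A : set 'rV[R]_n) : measurable A ->
  half_line A = [set x | ((G x)%:E < P A)%E].
Proof.
move=> mA; rewrite /half_line /Phi_inv.
have fA : P A \is a fin_num by exact: fin_num_measure.
have PA1 : (P A <= 1)%E by exact: probability_le1.
have [p0|pn0] := eqVneq (P A) 0%E.
  apply/seteqP; split=> x /=; first by rewrite ltNge leNye.
  by rewrite p0 lte_fin ltNge gauss_cdf_ge0.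
have [p1|pn1] := eqVneq (P A) 1%E.
  apply/seteqP; split=> x /= _; last by rewrite ltry.
  by rewrite p1 lte_fin gauss_cdf_lt1.
have [|x xE] := @gauss_cdf_onto R (fine (P A)).
  by rewrite -!lte_fin fineK// !lt_neqAle eq_sym pn0 pn1 measure_ge0.
have := @xgetPex _ 0 [set z | Phi z = P A] (ex_intro _ x _).
rewrite /= PhiE xE fineK// => /(_ erefl); move: (xget _ _) => z zE.
by apply/seteqP; split=> y /=; rewrite -zE PhiE !lte_fin ltr_gauss_cdf.
Qed.

Variable f : 'rV[R]_n -> R.
Hypothesis mf : measurable_fun setT f.

Lemma measurable_superlevel_row r : measurable [set y | r < f y].
Proof.
rewrite -[X in measurable X]setTI -preimage_itvoy.
by apply: mf => //; exact: measurable_itv.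
Qed.

(** The sets where f > r + 1 / (k + 1) increase to the one where f > r, so a strict bound on the
    measure survives a slightly higher level. *)
Lemma superlevel_right_continuous (r : R) (p : \bar R) :
  (p < P [set y | (r < f y)%R])%E ->
  exists2 r', r < r' & (p < P [set y | (r' < f y)%R])%E.
Proof.
move=> pr.
have : P [set y | r + k.+1%:R^-1 < f y] @[k --> \oo] -->
    P (\bigcup_k [set y | r + k.+1%:R^-1 < f y]).
  apply: nondecreasing_cvg_mu => //.
  - by move=> k; exact: measurable_superlevel_row.
  - by apply: bigcup_measurable => k _; exact: measurable_superlevel_row.
  move=> i j ij; apply/subsetPset => y /=; apply: le_lt_trans.
  by rewrite lerD2l lef_pV2 ?posrE// ler_nat.
rewrite (_ : \bigcup_k _ = [set y | r < f y]); last first.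
  apply/seteqP; split=> [y [k _ /=]|y /= ry].
    by apply: lt_trans; rewrite ltrDl.
  have [k k1] : exists k : nat, k.+1%:R^-1 < f y - r.
    have fr : 0 < f y - r by rewrite subr_gt0.
    by have [N _ /(_ N (leqnn N))/= ?] := near_infty_natSinv_lt (PosNum fr); exists N.
  by exists k => //=; rewrite -ltrBrDl.
move=> cvgP; apply: contrapT => nr.
suff : (P [set y | (r < f y)%R] <= p)%E by rewrite leNgt pr.
apply: (cvge_to_le cvgP); apply: nearW => k /=; rewrite leNgt; apply/negP => pk.
by apply: nr; exists (r + k.+1%:R^-1) => //; rewrite ltrDl.
Qed.

Let m (r : R) := P [set y | (r < f y)%R].

Let m_nonincreasing r s : r <= s -> (m s <= m r)%E.
Proof.
move=> rs; apply: le_measure; rewrite ?inE; try exact: measurable_superlevel_row.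
by move=> y /=; exact: le_lt_trans.
Qed.

(** The value at x is the length of the positive part of S, and S is closed downwards because m is
    nonincreasing. It exceeds r exactly when r belongs to S; right continuity supplies the
    strictness. *)
Lemma rearrangement_gt (r x : R) : 0 <= r ->
  (r%:E < rearrangement f x)%E = ((G x)%:E < P [set y | (r < f y)%R])%E.
Proof.
move=> r0.
pose S : set mR := [set s | ((G x)%:E < m s)%E].
have iS : is_interval S.
  move=> a b _ Sb c /andP[_ cb]; rewrite /S/=; apply: lt_le_trans Sb _.
  exact: m_nonincreasing.
have mS : measurable S by exact: is_interval_measurable.
have fE : rearrangement f x = lebesgue_measure (S `&` `]0%R, +oo[%classic).
  rewrite /rearrangement -integral_indic//; apply: eq_integral => s _.
  rewrite half_lineE; last exact: measurable_superlevel_row.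
  by rewrite !indicE; congr (_%:R%:E); apply/idP/idP; rewrite !inE.
have mSI : measurable (S `&` `]0%R, +oo[%classic) by exact: measurableI.
rewrite fE; apply/idP/idP => [rS|Gr].
  rewrite ltNge; apply/negP => Gr; move: rS; apply/negP; rewrite -leNgt.
  have -> : r%:E = lebesgue_measure `]0%R, r]%classic.
    rewrite lebesgue_measure_itv/= lte_fin; case: ltP => [|r0']; rewrite ?oppr0 ?adde0//.
    by congr (_%:E); apply/eqP; rewrite eq_le r0 r0'.
  apply: le_measure; rewrite ?inE// => s []; rewrite /S/= !in_itv/= andbT => Gs ->/=.
  rewrite leNgt; apply/negP => rs; move: (lt_le_trans Gs (m_nonincreasing (ltW rs))).
  by rewrite ltNge Gr.
have [r' rr' Gr'] := superlevel_right_continuous Gr.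
apply: (@lt_le_trans _ _ r'%:E); first by rewrite lte_fin.
have -> : r'%:E = lebesgue_measure `]0%R, r']%classic.
  by rewrite lebesgue_measure_itv/= lte_fin (le_lt_trans r0 rr') oppr0 adde0.
apply: le_measure; rewrite ?inE// => s; rewrite /= !in_itv/= => /andP[s0 sr'].
by split; [exact: lt_le_trans Gr' (m_nonincreasing sr')|rewrite s0].
Qed.

Lemma rearrangement_ge0 x : (0 <= rearrangement f x)%E.
Proof. by apply: integral_ge0 => r _; rewrite lee_fin. Qed.

Lemma gamma_superlevel_rearrangement r : 0 <= r ->
  gamma [set x | (r%:E < rearrangement f x)%E] = P [set y | (r < f y)%R].
Proof.
move=> r0; rewrite -[RHS]gamma_cdf_lt; last first.
  rewrite measure_ge0 probability_le1//; exact: measurable_superlevel_row.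
by congr (gamma _); apply/seteqP; split=> x; rewrite /= rearrangement_gt.
Qed.

Lemma rearrangement_nonincreasing x y : x <= y ->
  (rearrangement f y <= rearrangement f x)%E.
Proof.
move=> xy; rewrite leNgt; apply/negP.
case xE : (rearrangement f x) => [r||]; last 2 first.
- by rewrite ltNge leey.
- by have := rearrangement_ge0 x; rewrite xE.
have r0 : 0 <= r by have := rearrangement_ge0 x; rewrite xE lee_fin.
rewrite rearrangement_gt// => Gy.
have : (r%:E < rearrangement f x)%E.
  rewrite rearrangement_gt//; apply: le_lt_trans Gy.
  by rewrite lee_fin gauss_cdf_nondecreasing.
by rewrite xE ltxx.
Qed.

Lemma measurable_superlevel_nonincreasing (g : mR -> \bar R) :
  (forall x y, x <= y -> (g y <= g x)%E) -> measurable_fun setT g.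
Proof.
move=> gxy; apply: measurable_superlevel => r.
apply: is_interval_measurable => a b _ gb c /andP[_ cb] /=.
by apply: lt_le_trans gb _; exact: gxy.
Qed.

Lemma measurable_rearrangement : measurable_fun setT (rearrangement f : mR -> \bar R).
Proof.
apply: measurable_superlevel_nonincreasing; exact: rearrangement_nonincreasing.
Qed.

End rearrangement_theory.

(** * Sup-convolutions: level sets, measurability, and comparison with the rearrangement *)

Section sup_convolution_theory.
Context (R : realType) (V : lmodType R) (N : V -> R) (lambda : R).

Lemma Qop_gt (h : V -> \bar R) (z : V) (t : \bar R) :
  (t < Qop N lambda h z)%E <->
  exists w, (t < h (z + lambda *: w)%R * (expR (- (lambda * N w ^+ 2 / 2)))%:E)%E.
Proof.
split=> [/ereal_sup_gt[_ [w _ <-] tw]|[w tw]]; first by exists w.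
by apply: lt_le_trans tw _; apply: ereal_sup_ubound; exists w.
Qed.

Lemma Qop_ge0 (h : V -> \bar R) (z : V) : (forall x, 0 <= h x)%E ->
  (0 <= Qop N lambda h z)%E.
Proof.
move=> h0; apply: (@le_trans _ _ (h (z + lambda *: 0)%R *
   (expR (- (lambda * N 0%R ^+ 2 / 2)))%:E)%E).
  by rewrite mule_ge0// lee_fin expR_ge0.
by apply: ereal_sup_ubound; exists 0.
Qed.

End sup_convolution_theory.

Lemma ltr_powR2r (R : realType) (q x y : R) : 0 < q -> 0 <= x -> 0 <= y ->
  (x `^ q < y `^ q) = (x < y).
Proof.
move=> q0 x0 y0; apply/idP/idP; last exact: gt0_ltr_powR.
by apply: contraTT; rewrite -!leNgt; apply: ge0_ler_powR => //; exact: ltW.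
Qed.

Section sup_convolution_rearrangement.
Context (R : realType) (n : nat) (lambda : R).
Local Notation mR := (measurableTypeR R).
Local Notation gamma := (gamma R).
Local Notation G := (@gauss_cdf R).
Local Notation P := (gaussian R n).
Hypothesis lambda0 : 0 < lambda.

Let kernel (t : R) := expR (- (t / (2 * lambda))).

Let kernel_anti s t : s <= t -> kernel t <= kernel s.
Proof.
move=> st; rewrite ler_expR lerN2 ler_wpM2r// invr_ge0 mulr_ge0// ltW//.
Qed.

(** Substituting u = z + lambda w makes the weight a function of the squared distance from z to u,
    the quantity that defines enlargements. *)
Lemma row_dist_enorm (z u : 'rV[R]_n) :
  lambda * enorm (lambda^-1 *: (u - z)) ^+ 2 / 2 = row_dist z u / (2 * lambda).
Proof.
rewrite /enorm sqr_sqrtr; last by apply: sumr_ge0 => i _; rewrite sqr_ge0.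
rewrite (_ : \sum_i _ = lambda^-1 ^+ 2 * row_dist z u).
  by field; rewrite gt_eqF.
rewrite /row_dist mulr_sumr; apply: eq_bigr => i _.
by rewrite !mxE; ring.
Qed.

Lemma Q_rV_gt (f : 'rV[R]_n -> R) (z : 'rV[R]_n) (r : R) :
  (r%:E < Q_rV lambda (EFin \o f) z)%E <->
  exists u, r < f u * expR (- (row_dist z u / (2 * lambda))).
Proof.
have lu u : z + lambda *: (lambda^-1 *: (u - z)) = u.
  by rewrite scalerA divff ?gt_eqF// scale1r subrKC.
split=> [/Qop_gt[w]|[u ru]].
  have -> : w = lambda^-1 *: ((z + lambda *: w) - z).
    by rewrite addrAC subrr add0r scalerA mulVf ?gt_eqF// scale1r.
  by rewrite lu row_dist_enorm /= -EFinM lte_fin => rw; eexists; exact: rw.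
apply/Qop_gt; exists (lambda^-1 *: (u - z)).
by rewrite lu row_dist_enorm /= -EFinM lte_fin.
Qed.

Lemma Q_R_gt (g : R -> \bar R) (z : R) (t : \bar R) :
  (t < Q_R lambda g z)%E <->
  exists u, (t < g u * (expR (- ((z - u) ^+ 2 / (2 * lambda))))%:E)%E.
Proof.
have lu u : z + lambda * (lambda^-1 * (u - z)) = u.
  by rewrite mulrA divff ?gt_eqF// mul1r subrKC.
have eu u : lambda * `|lambda^-1 * (u - z)| ^+ 2 / 2 = (z - u) ^+ 2 / (2 * lambda).
  by rewrite real_normK ?num_real//; field; rewrite gt_eqF.
split=> [/Qop_gt[w tw]|[u tu]].
  exists (z + lambda * w); rewrite -eu.
  suff -> : lambda^-1 * (z + lambda * w - z) = w by [].
  by field; rewrite gt_eqF.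
apply/Qop_gt; exists (lambda^-1 * (u - z)).
change (t < g (z + lambda * (lambda^-1 * (u - z)))%R *
  (expR (- (lambda * `|lambda^-1 * (u - z)| ^+ 2 / 2)))%:E)%E.
by rewrite lu eu.
Qed.

Lemma measurable_Q_rV (f : 'rV[R]_n -> R) : (forall x, 0 <= f x) ->
  measurable_fun setT (Q_rV lambda (EFin \o f)).
Proof.
move=> f0; apply: measurable_superlevel => r; apply: open_measurable_row.
(* A pair is a centre and a squared radius. By continuity of [kernel] the radius can be taken
   strictly larger than the distance to z, as an open ball requires. *)
pose U : set 'rV[R]_n :=
  \bigcup_(p in [set p : 'rV[R]_n * R | r < f p.1 * kernel p.2])
    [set z | \sum_i (z ord0 i - p.1 ord0 i) ^+ 2 < p.2].
have oU : open U by apply: bigcup_open => p _; exact: open_sqdist_row.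
suff UE : [set z : 'rV[R]_n | (r%:E < Q_rV lambda (EFin \o f) z)%E] = U.
  by rewrite -UE in oU; exact: oU.
apply/seteqP; split=> [z /Q_rV_gt[u ru]|z [[u t] /= ru zt]]; last first.
  apply/Q_rV_gt; exists u; apply: (lt_le_trans ru).
  by rewrite ler_wpM2l ?f0// kernel_anti// ltW.
have : f u * kernel t @[t --> row_dist z u] --> f u * kernel (row_dist z u).
  apply: cvgM; first exact: cvg_cst.
  apply: (@cvg_comp _ _ _ (fun t => - (t / (2 * lambda))) expR).
    apply: cvgN; apply: cvgM; [exact: cvg_id|exact: cvg_cst].
  exact: continuous_expR.
move=> /cvgr_gt/(_ _ ru)/nbhs_ballP[e /= e0 He].
exists (u, row_dist z u + e / 2) => /=; last by rewrite ltrDl divr_gt0.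
apply: He; rewrite /ball/= opprD addrA subrr add0r normrN gtr0_norm ?divr_gt0//.
by rewrite ltr_pdivrMr//; lra.
Qed.

Lemma Q_rV_ge0 (f : 'rV[R]_n -> R) z : (forall x, 0 <= f x) ->
  (0 <= Q_rV lambda (EFin \o f) z)%E.
Proof. by move=> f0; apply: Qop_ge0 => x; rewrite lee_fin. Qed.

Lemma Q_R_nonincreasing (g : R -> \bar R) x y :
  (forall x y, x <= y -> (g y <= g x)%E) -> x <= y ->
  (Q_R lambda g y <= Q_R lambda g x)%E.
Proof.
move=> gxy xy; apply: ge_ereal_sup => _ [w _ <-].
apply: (@le_trans _ _ (g (x + lambda *: (w : R^o))%R *
    (expR (- (lambda * `|w| ^+ 2 / 2)))%:E)%E).
  by rewrite lee_wpmul2r ?lee_fin ?expR_ge0// gxy// lerD2r.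
by apply: ereal_sup_ubound; exists w.
Qed.

Variable f : 'rV[R]_n -> R.
Hypotheses (mf : measurable_fun setT f) (f0 : forall x, 0 <= f x).

(** A suitable u gives a level s with G u < P [f > s] and r < s e. For u < z the enlargement of this
    level set by z - u has measure at least G z, and on it the weight is at least e, so [Q_rV]
    exceeds r. For z <= u the level set itself is large enough. *)
Lemma superlevel_Q_rearrangement (r z : R) : 0 < r ->
  (r%:E < Q_R lambda (rearrangement f) z)%E ->
  ((G z)%:E <= P [set y | (r%:E < Q_rV lambda (EFin \o f) y)%E])%E.
Proof.
move=> r0 /Q_R_gt[u].
set e := expR _; have e0 : 0 < e by exact: expR_gt0.
have e1 : e <= 1.
  rewrite -[leRHS]expR0 ler_expR oppr_le0 divr_ge0 ?sqr_ge0//.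
  by rewrite mulr_ge0// ltW.
rewrite -lte_pdivrMr// -EFinM rearrangement_gt//; last by rewrite divr_ge0// ltW.
move=> /(superlevel_right_continuous mf)[s]; rewrite ltr_pdivrMr// => rs Gs.
have s0 : 0 < s by move: (lt_trans r0 rs); rewrite pmulr_lgt0.
have mQ : measurable [set y | (r%:E < Q_rV lambda (EFin \o f) y)%E].
  rewrite -[X in measurable X]setTI; apply: emeasurable_fun_o_infty => //.
  exact: measurable_Q_rV.
have ms : measurable [set y | s < f y] by exact: measurable_superlevel_row.
have [zu|uz] := leP z u.
  apply: (@le_trans _ _ (G u)%:E); first by rewrite lee_fin gauss_cdf_nondecreasing.
  apply: (le_trans (ltW Gs)); apply: le_measure; rewrite ?inE// => y /= sy.
  apply/Q_rV_gt; exists y; rewrite (_ : row_dist y y = 0).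
    rewrite mul0r oppr0 expR0 mulr1; apply: lt_trans sy; apply: lt_le_trans rs _.
    by rewrite ler_piMr// ltW.
  by rewrite /row_dist big1// => i _; rewrite subrr expr0n.
have zu0 : 0 < z - u by rewrite subr_gt0.
rewrite -[z](subrKC u); apply: le_trans (isoperimetric_row ms zu0 (ltW Gs)) _.
apply: le_measure; rewrite ?inE//.
  by apply: open_measurable_row; exact: open_enlarge_row.
move=> y [a /= sa ya]; apply/Q_rV_gt; exists a; apply: (lt_le_trans rs).
apply: (@le_trans _ _ (s * kernel (row_dist y a))).
  by rewrite ler_pM2l// kernel_anti// ltW.
by rewrite ler_wpM2r ?expR_ge0// ltW.
Qed.

Lemma measurable_Q_rearrangement :
  measurable_fun setT (Q_R lambda (rearrangement f) : mR -> \bar R).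
Proof.
apply: measurable_superlevel_nonincreasing => x y.
by apply: Q_R_nonincreasing => ? ?; exact: rearrangement_nonincreasing.
Qed.

Lemma Q_rearrangement_ge0 z : (0 <= Q_R lambda (rearrangement f) z)%E.
Proof. by apply: Qop_ge0 => x; exact: rearrangement_ge0. Qed.

Lemma integral_Q_rearrangement_le :
  (\int[gamma]_z Q_R lambda (rearrangement f) z <=
   \int[P]_y Q_rV lambda (EFin \o f) y)%E.
Proof.
apply: ge0_le_integral_superlevel.
- exact: measurable_Q_rearrangement.
- exact: Q_rearrangement_ge0.
- exact: measurable_Q_rV.
- by move=> y; exact: Q_rV_ge0.
move=> r r0.
have mQ : measurable [set y | (r%:E < Q_rV lambda (EFin \o f) y)%E].
  rewrite -[X in measurable X]setTI; apply: emeasurable_fun_o_infty => //.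
  exact: measurable_Q_rV.
(* With the right side written as the measure of a sublevel set of G, the pointwise bound becomes an
   inclusion. *)
rewrite -[leRHS]gamma_cdf_le ?measure_ge0 ?probability_le1//.
apply: le_measure; rewrite ?inE; last by move=> z; exact: superlevel_Q_rearrangement.
- rewrite -[X in measurable X]setTI; apply: emeasurable_fun_o_infty => //.
  exact: measurable_Q_rearrangement.
- rewrite -[X in measurable X]setTI; apply: emeasurable_fun_infty_c => //.
  by apply/measurable_EFinP; exact: measurable_gauss_cdf.
Qed.

Lemma integral_rearrangement_power (p : R) : 0 < p ->
  (\int[gamma]_x (rearrangement f x `^ p) = \int[P]_y ((f y)%:E `^ p))%E.
Proof.
move=> p0.
have lt_power (r : R) (y : \bar R) : 0 < r -> (0 <= y)%E ->
    (r%:E < y `^ p)%E = ((r `^ p^-1)%:E < y)%E.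
  move=> r0; case: y => [y||//]; last by rewrite poweRyr ?gt_eqF// !ltry.
  rewrite lee_fin => y0; rewrite poweR_EFin !lte_fin.
  rewrite -[in RHS](@powRr1 _ y)// -[in RHS](@divff _ p) ?gt_eqF// powRrM.
  by rewrite ltr_powR2r ?invr_gt0 ?powR_ge0 ?(ltW r0).
have mr : measurable_fun setT (fun x : mR => rearrangement f x `^ p)%E.
  apply: (measurableT_comp (measurable_poweR _)).
  exact: measurable_rearrangement.
have mfp : measurable_fun setT (fun y => (f y)%:E `^ p)%E.
  by apply: (measurableT_comp (measurable_poweR _)); exact/measurable_EFinP.
have levels r : 0 < r -> gamma [set x | (r%:E < rearrangement f x `^ p)%E] =
    P [set y | (r%:E < (f y)%:E `^ p)%E].
  move=> r0; transitivity (P [set y | r `^ p^-1 < f y]).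
    rewrite -gamma_superlevel_rearrangement ?powR_ge0//; congr (gamma _).
    by apply/seteqP; split=> x /=; rewrite lt_power// rearrangement_ge0.
  congr (P _); apply/seteqP; split=> y; rewrite /mkset lt_power ?lee_fin//.
have r_ge0 x : (0 <= rearrangement f x `^ p)%E by exact: poweR_ge0.
have fp_ge0 y : (0 <= (f y)%:E `^ p)%E by exact: poweR_ge0.
apply/eqP; rewrite eq_le; apply/andP; split.
  apply: (ge0_le_integral_superlevel mr r_ge0 mfp fp_ge0) => r r0.
  by rewrite le_eqVlt; apply/orP; left; apply/eqP; exact: levels.
apply: (ge0_le_integral_superlevel mfp fp_ge0 mr r_ge0) => r r0.
by rewrite le_eqVlt; apply/orP; left; apply/eqP/esym; exact: levels.
Qed.

End sup_convolution_rearrangement.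

(** * The Prekopa-Leindler inequality *)

(** Young's inequality with conjugate exponents 1 / s and 1 / (1 - s). *)
Lemma powR_weighted_amgm (R : realType) (a b s : R) :
  0 <= a -> 0 <= b -> 0 < s -> 0 < 1 - s ->
  a `^ s * b `^ (1 - s) <= s * a + (1 - s) * b.
Proof.
move=> a0 b0 s0 s1.
have := @conjugate_powR R (a `^ s) (b `^ (1 - s)) s^-1 (1 - s)^-1
  (powR_ge0 _ _) (powR_ge0 _ _).
rewrite !invr_gt0 !invrK subrKC => /(_ s0 s1 erefl).
by rewrite -!powRrM !divff ?gt_eqF// !powRr1// [a * s]mulrC [b * _]mulrC.
Qed.

Section prekopa_leindler_line.
Context (R : realType).
Local Notation mR := (measurableTypeR R).
Local Notation mu := (@lebesgue_measure R).
Local Notation phi := (@gauss_pdf R).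

Let mu_affine (a b : R) (A : set mR) : 0 < a -> measurable A ->
  mu ((fun z => a^-1 * z + b) @^-1` A) = (a%:E * mu A)%E.
Proof.
move=> a0 mA; have ai0 : a^-1 != 0 by rewrite invr_eq0 gt_eqF.
rewrite -(lebesgue_measure_affine b ai0 mA) normfV gtr0_norm// muleA -EFinM.
by rewrite divff ?gt_eqF// mul1e.
Qed.

(* Two translates of scaled copies of the halves of A on either side of a point
   and an interval around that point are disjoint. *)
Lemma lebesgue_sumset_itv (s b x0 : R) (A C : set mR) : 0 < s -> 0 < b ->
  measurable A -> measurable C -> A x0 ->
  (forall x z, A x -> `|z - s * x| < b -> C z) ->
  (s%:E * mu A + (2 * b)%:E <= mu C)%E.
Proof.
move=> s0 b0 mA mC Ax0 AC; apply/lee_addgt0Pr => e e0.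
(* The hypothesis on C is strict, so the outer pieces are moved by some d < b, at a cost of at most
   e; b / 2 keeps d positive. *)
pose d := Num.max (b - e / 2) (b / 2).
have d0 : 0 < d by rewrite lt_max (divr_gt0 b0)// orbT.
have db : d < b by rewrite gt_max; apply/andP; split; lra.
have de : 2 * b <= 2 * d + e.
  have : b - e / 2 <= d by rewrite le_max lexx.
  lra.
pose Al := A `&` `]-oo, x0[%classic; pose Ar := A `&` `]x0, +oo[%classic.
have mAl : measurable Al by exact: measurableI.
have mAr : measurable Ar by exact: measurableI.
(* L is s Al - d and H is s Ar + d, which leaves the interval I around s x0 free. *)
pose L := (fun z : mR => s^-1 * z + s^-1 * d) @^-1` Al.
pose H := (fun z : mR => s^-1 * z + - (s^-1 * d)) @^-1` Ar.
pose I : set mR := `](s * x0 - d), (s * x0 + d)[%classic.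
have mL : measurable L.
  by rewrite -[X in measurable X]setTI; exact: measurable_affine.
have mH : measurable H.
  by rewrite -[X in measurable X]setTI; exact: measurable_affine.
have sV x : s * (s^-1 * x) = x by rewrite mulrA divff ?gt_eqF// mul1r.
have muA : mu A = (mu Al + mu Ar)%E.
  have -> : A = Al `|` Ar `|` [set x0].
    apply/seteqP; split=> x; last by move=> [[[]|[]]|->].
    move=> Ax; have [xx0|xx0|->] := ltgtP x x0; [| |by right].
      by left; left; split => //=; rewrite in_itv.
    by left; right; split => //=; rewrite in_itv/= xx0.
  rewrite measureU//=; [|exact: measurableU|].
    rewrite lebesgue_measure_set1 adde0 measureU//.
    by apply/seteqP; split=> // x [[_ /=]] + [_ /=]; rewrite !in_itv/=; lra.
  apply/seteqP; split=> // x [[[_ /=]|[_ /=]]] + /= xx0; rewrite xx0 in_itv/= ?ltxx//.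
have LIH : (mu L + mu I + mu H <= mu C)%E.
  have LE z : L z -> z + d < s * x0.
    by move=> [_ /=]; rewrite in_itv/= -mulrDr mulrC ltr_pdivrMr// [x0 * s]mulrC.
  have HE z : H z -> s * x0 < z - d.
    move=> [_ /=]; rewrite in_itv/= andbT -mulrBr mulrC ltr_pdivlMr//.
    by rewrite [x0 * s]mulrC.
  have IE z : I z -> s * x0 - d < z /\ z < s * x0 + d.
    by rewrite /I/= in_itv/= => /andP[].
  have LI0 : L `&` I = set0.
    by apply/seteqP; split=> // z [/LE + /IE[+ _]]; lra.
  have LIH0 : (L `|` I) `&` H = set0.
    by apply/seteqP; split=> // z [[/LE|/IE[_]] + /HE]; lra.
  have mI : measurable I by exact: measurable_itv.
  have mLI : measurable (L `|` I) by exact: measurableU.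
  have E1 : mu (L `|` I) = (mu L + mu I)%E by rewrite measureU.
  have E2 : mu (L `|` I `|` H) = (mu (L `|` I) + mu H)%E by rewrite measureU.
  rewrite -E1 -E2.
  apply: le_measure; rewrite ?inE//; first exact: measurableU.
  move=> z [[[Az _]|]|[Az _]].
  - by apply: (AC _ _ Az); rewrite mulrDr !sV opprD addrA subrr sub0r normrN gtr0_norm.
  - move=> /IE[z1 z2]; apply: (AC _ _ Ax0).
    by rewrite ltr_norml; apply/andP; split; lra.
  - by apply: (AC _ _ Az); rewrite mulrDr mulrN !sV opprB addrC subrK gtr0_norm.
apply: (@le_trans _ _ (mu L + mu I + mu H + e%:E)%E); last exact: leeD2r.
have -> : mu I = (2 * d)%:E.
  rewrite lebesgue_measure_itv/= lte_fin ifT; last by lra.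
  by rewrite -EFinD; congr (_%:E); ring.
rewrite /L /H !mu_affine// muA ge0_muleDr//.
rewrite [leRHS](_ : _ = (s%:E * mu Al + s%:E * mu Ar) + (2 * d + e)%:E)%E; last first.
  by rewrite EFinD addeA; congr (_ + _)%E; rewrite addeAC.
by apply: leeD2l; rewrite lee_fin.
Qed.


Let superlevel_gauss_pdf (t : R) : 0 < t < 1 -> exists2 b, 0 < b &
  [set y | t < phi y / normal_peak 1] = `](- b), b[%classic.
Proof.
move=> /andP[t0 t1]; have lt0 : ln t < 0 by apply: ln_lt0; rewrite t0.
have p0 : 0 < normal_peak 1 :> R by rewrite normal_peak_gt0// oner_eq0.
exists (Num.sqrt (- 2 * ln t)); first by rewrite sqrtr_gt0; lra.
have tE : t = expR (ln t) by rewrite lnK// posrE.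
have E y : (t < phi y / normal_peak 1) = (`|y| < Num.sqrt (- 2 * ln t)).
  rewrite gauss_pdfE mulrAC divff ?gt_eqF// mul1r [in LHS]tE ltr_expR.
  rewrite -sqrtr_sqr ltr_sqrt; last by lra.
  by apply/idP/idP; lra.
by apply/seteqP; split=> y /=; rewrite E in_itv/= ltr_norml.
Qed.

(** W is abstract because all truncations h of one function g share W = [Q_R lambda g]; the bound M
    makes the supremum and the integral of u finite. *)
Variables (lambda : R) (W : R -> \bar R) (h : R -> R) (M : R).
Hypotheses (lambda0 : 0 < lambda).
Hypotheses (mW : measurable_fun [set: mR] W) (W0 : forall z, (0 <= W z)%E).
Hypotheses (mh : measurable_fun [set: mR] (h : mR -> mR)).
Hypothesis hM : forall x, 0 <= h x <= M.
Hypothesis hW : forall z u,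
  ((h u * expR (- ((z - u) ^+ 2 / (2 * lambda))))%:E <= W z)%E.

Let p := 1 + lambda.
Let s := p^-1.
Let u (x : R) := h x `^ p * phi x.
Let w (z : R) := (W z * (phi z)%:E)%E.
Let c := (normal_peak 1 : R).

(* With [z = s x + (1 - s) y] the Gaussian weights satisfy
   [phi x ^ s * phi y ^ (1 - s) = phi z * expR (- (z - x) ^ 2 / (2 lambda))]. *)
Let prekopa_pointwise (a b x y : R) : 0 < a -> 0 < b -> a < u x -> b < phi y ->
  ((a `^ s * b `^ (1 - s))%:E < w (s * x + (1 - s) * y)%R)%E.
Proof.
move=> a0 b0 au bphi; set z := s * x + _.
have p0 : 0 < p by exact: addr_gt0.
have s0 : 0 < s by rewrite invr_gt0.
have s1 : s < 1 by rewrite invf_lt1// ltrDl.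
have c0 : 0 < c by rewrite normal_peak_gt0// oner_eq0.
have phiE v : phi v = expR (ln c - v ^+ 2 / 2).
  by rewrite gauss_pdfE expRD lnK.
have phis v q : phi v `^ q = expR (q * (ln c - v ^+ 2 / 2)).
  by rewrite /powR phiE gt_eqF ?expR_gt0// expRK.
have h0 : 0 <= h x by have /andP[] := hM x.
have as_lt : a `^ s < h x * phi x `^ s.
  rewrite -[X in X * _](powRr1 h0) -(divff (lt0r_neq0 p0)) powRrM.
  rewrite -powRM ?powR_ge0 ?gauss_pdf_ge0//.
  by rewrite ltr_powR2r ?(ltW a0) ?mulr_ge0 ?powR_ge0 ?gauss_pdf_ge0.
have bs_lt : b `^ (1 - s) < phi y `^ (1 - s).
  by rewrite ltr_powR2r ?(ltW b0) ?gauss_pdf_ge0// subr_gt0.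
have hs : h x * phi x `^ s * phi y `^ (1 - s) =
    (h x * expR (- ((z - x) ^+ 2 / (2 * lambda)))) * phi z.
  rewrite !phis phiE -!mulrA -!expRD; congr (_ * expR _).
  rewrite /z /s /p; field.
  by apply/andP; split; rewrite gt_eqF// addr_gt0.
apply: (@lt_le_trans _ _ (h x * phi x `^ s * phi y `^ (1 - s))%:E).
  by rewrite lte_fin ltr_pM ?powR_ge0.
by rewrite hs EFinM /w lee_wpmul2r ?lee_fin ?gauss_pdf_ge0.
Qed.

Let p0 : 0 < p. Proof. exact: addr_gt0. Qed.
Let s0 : 0 < s. Proof. by rewrite invr_gt0. Qed.
Let s1 : 0 < 1 - s. Proof. by rewrite subr_gt0 invf_lt1// ltrDl. Qed.
Let c0 : 0 < c. Proof. by rewrite normal_peak_gt0// oner_eq0. Qed.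
Let u0 x : 0 <= u x. Proof. by rewrite mulr_ge0 ?powR_ge0 ?gauss_pdf_ge0. Qed.
Let w0 z : (0 <= w z)%E. Proof. by rewrite mule_ge0// lee_fin gauss_pdf_ge0. Qed.

Let mu_u : measurable_fun [set: mR] (u : mR -> mR).
Proof.
apply: measurable_funM; last exact: measurable_gauss_pdf.
exact: (measurableT_comp (measurable_powR _)).
Qed.

Let mw : measurable_fun [set: mR] w.
Proof.
by apply: emeasurable_funM => //; apply/measurable_EFinP; exact: measurable_gauss_pdf.
Qed.

(* Brunn-Minkowski for the superlevel sets, normalized so that both [u / U] and
   [phi / c] have supremum one. *)
Let prekopa_level (U t : R) : 0 < U -> (forall x, u x <= U) ->
  (forall e, 0 < e -> exists x, U - e < u x) -> 0 < t ->
  (s%:E * mu [set x | (t%:E < (u x / U)%:E)%E] +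
   (1 - s)%:E * mu [set y | (t%:E < (phi y / c)%:E)%E] <=
   mu [set z | (t%:E < w z * (U `^ s * c `^ (1 - s))^-1%:E)%E])%E.
Proof.
move=> U0 uU Uu t0; set K := U `^ s * _.
have K0 : 0 < K by rewrite mulr_gt0 ?powR_gt0.
have [t1|t1] := leP 1 t.
  rewrite (_ : [set x | (t%:E < (u x / U)%:E)%E] = set0); last first.
    apply/seteqP; split=> // x /=; rewrite lte_fin ltNge; apply/negP/negPn.
    by apply: le_trans t1; rewrite ler_pdivrMr// mul1r.
  rewrite (_ : [set x | (t%:E < (phi x / c)%:E)%E] = set0); last first.
    apply/seteqP; split=> // x /=; rewrite lte_fin ltNge; apply/negP/negPn.
    by apply: le_trans t1; rewrite ler_pdivrMr// mul1r gauss_pdf_le_peak.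
  by rewrite !measure0 !mule0 adde0 measure_ge0.
have [|b b0 bE] := @superlevel_gauss_pdf t; first by rewrite t0.
have -> : ((1 - s)%:E * mu [set y | (t%:E < (phi y / c)%:E)%E] =
    (2 * ((1 - s) * b))%:E)%E.
  rewrite [X in mu X](_ : _ = `](- b), b[%classic); last by rewrite -bE.
  rewrite lebesgue_measure_itv/= lte_fin ifT; last by lra.
  by rewrite -EFinB -EFinM; congr (_%:E); ring.
(* As t < 1 and U is the supremum, the level set of u / U contains a point, around which
   [lebesgue_sumset_itv] splits it. *)
have [x0 x0P] : exists x, U - U * (1 - t) < u x.
  by apply: Uu; rewrite mulr_gt0// subr_gt0.
apply: (@lebesgue_sumset_itv s ((1 - s) * b) x0 _ _ s0 (mulr_gt0 s1 b0)).
- rewrite -[X in measurable X]setTI; apply: emeasurable_fun_o_infty => //.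
  by apply/measurable_EFinP; apply: measurable_funM.
- rewrite -[X in measurable X]setTI; apply: emeasurable_fun_o_infty => //.
  exact: emeasurable_funM.
- by rewrite /= lte_fin ltr_pdivlMr//; move: x0P; lra.
move=> x z /=; rewrite lte_fin ltr_pdivlMr// => tu zx.
(* Then z = s x + (1 - s) y, and the distance condition on z says that y is in the level interval of
   the density. *)
pose y := (z - s * x) / (1 - s).
have yb : t < phi y / normal_peak 1.
  have : [set y | t < phi y / normal_peak 1] y; last by [].
  rewrite bE /= in_itv/= -ltr_norml /y normf_div [X in _ / X]gtr0_norm//.
  by rewrite ltr_pdivrMr// [b * _]mulrC.
rewrite ltr_pdivlMr// in yb.
have tU0 : 0 < t * U by rewrite mulr_gt0.
have tc0 : 0 < t * c by rewrite mulr_gt0.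
have := prekopa_pointwise tU0 tc0 tu yb.
rewrite (_ : s * x + (1 - s) * y = z); last first.
  by rewrite /y mulrCA divff ?mulr1 ?gt_eqF// subrKC.
rewrite !powRM ?(ltW t0) ?(ltW U0) ?(ltW c0)// mulrACA -powRD; last first.
  by apply/implyP => _; rewrite gt_eqF.
rewrite subrKC powRr1 ?(ltW t0)// -/K => tKw.
by rewrite lte_pdivlMr.
Qed.

(** Integrating [prekopa_level] over t bounds s X / U + (1 - s) / c by the integral of w / K, where
    X is the integral of u and [phi] has integral 1. The weighted arithmetic-geometric inequality
    turns the sum into a product, in which U and c cancel against K. *)
Lemma gaussian_prekopa_bounded :
  ((\int[gamma R]_x (h x `^ p)%:E) `^ s <= \int[gamma R]_z W z)%E.
Proof.
have mhp : measurable_fun [set: mR] (fun x => (h x `^ p)%:E).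
  by apply/measurable_EFinP; exact: (measurableT_comp (measurable_powR _)).
have IX : (\int[gamma R]_x (h x `^ p)%:E = \int[mu]_x (u x)%:E)%E.
  have hp0 x : (0 <= (h x `^ p)%:E)%E by rewrite lee_fin powR_ge0.
  rewrite (ge0_integral_gamma mhp hp0).
  by apply: eq_integral => x _; rewrite -EFinM.
rewrite {}IX ge0_integral_gamma// -/w.
have M0 : 0 <= M by have /andP[h0 h1] := hM 0; exact: le_trans h1.
have uM x : u x <= M `^ p * phi x.
  rewrite ler_wpM2r ?gauss_pdf_ge0//; have /andP[h0 h1] := hM x.
  by apply: ge0_ler_powR => //; rewrite ?nnegrE// ltW.
have muE : measurable_fun [set: mR] (fun x => (u x)%:E) by exact/measurable_EFinP.
have mphi : measurable_fun [set: mR] (fun x => (phi x)%:E).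
  by apply/measurable_EFinP; exact: measurable_gauss_pdf.
have iphi : (\int[mu]_x (phi x)%:E = 1)%E by exact: integral_normal_pdf.
have X0 : (0 <= \int[mu]_x (u x)%:E)%E.
  by apply: integral_ge0 => x _; rewrite lee_fin.
have Xfin : (\int[mu]_x (u x)%:E)%E \is a fin_num.
  rewrite ge0_fin_numE//.
  apply: (@le_lt_trans _ _ (\int[mu]_x ((M `^ p)%:E * (phi x)%:E))%E).
    apply: ge0_le_integral => //.
    - by move=> x _; rewrite lee_fin.
    - exact: measurable_funeM.
    - by move=> x _; rewrite -EFinM lee_fin.
  rewrite ge0_integralZl// ?iphi ?mule1 ?ltry ?lee_fin ?powR_ge0//.
  by move=> x _; rewrite lee_fin gauss_pdf_ge0.
pose U := sup (range u).
have supU : has_sup (range u).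
  split; first by exists (u 0), 0.
  exists (M `^ p * c) => _ [x _ <-]; apply: (le_trans (uM x)).
  by rewrite ler_wpM2l ?powR_ge0// gauss_pdf_le_peak.
have uU x : u x <= U by apply: sup_upper_bound => //; exists x.
have Uu e : 0 < e -> exists x, U - e < u x.
  by move=> e0; have [_ [x _ <-] ux] := sup_adherent e0 supU; exists x.
have [U0|U0] := leP U 0.
  rewrite (_ : (\int[mu]_x (u x)%:E)%E = 0%E).
    by rewrite poweR0r ?(gt_eqF s0)//; apply: integral_ge0 => z _; exact: w0.
  apply: integral0_eq => x _; congr (_%:E); apply/eqP.
  by rewrite eq_le u0 (le_trans (uU x)).
set K := U `^ s * c `^ (1 - s).
have K0 : 0 < K by rewrite mulr_gt0 ?powR_gt0.
pose F1 x := (u x / U)%:E; pose F2 x := (phi x / c)%:E; pose F3 z := (w z * K^-1%:E)%E.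
have mF1 : measurable_fun [set: mR] F1.
  by apply/measurable_EFinP; apply: measurable_funM.
have mF2 : measurable_fun [set: mR] F2.
  by apply/measurable_EFinP; apply: measurable_funM => //; exact: measurable_gauss_pdf.
have mF3 : measurable_fun [set: mR] F3 by exact: emeasurable_funM.
have F10 x : (0 <= F1 x)%E by rewrite lee_fin divr_ge0// ltW.
have F20 x : (0 <= F2 x)%E by rewrite lee_fin divr_ge0 ?gauss_pdf_ge0// ltW.
have F30 x : (0 <= F3 x)%E by rewrite mule_ge0// lee_fin invr_ge0 ltW.
have main : (s%:E * \int[mu]_x F1 x + (1 - s)%:E * \int[mu]_x F2 x <= \int[mu]_z F3 z)%E.
  rewrite !ge0_layer_cake//.
  rewrite -!ge0_integralZl//; last 4 first.
  - exact: measure_superlevel_measurable.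
  - by rewrite lee_fin ltW.
  - exact: measure_superlevel_measurable.
  - by rewrite lee_fin ltW.
  rewrite -ge0_integralD//; last 4 first.
  - by move=> t _; rewrite mule_ge0// lee_fin ltW.
  - by apply: measurable_funeM; exact: measure_superlevel_measurable.
  - by move=> t _; rewrite mule_ge0// lee_fin ltW.
  - by apply: measurable_funeM; exact: measure_superlevel_measurable.
  apply: ge0_le_integral => //.
  - by move=> t _; rewrite adde_ge0// mule_ge0// lee_fin ltW.
  - apply: emeasurable_funD; apply: measurable_funeM;
      exact: measure_superlevel_measurable.
  - exact: measure_superlevel_measurable.
  move=> t /=; rewrite in_itv/= andbT => t0; exact: prekopa_level.
have E1 : (\int[mu]_x F1 x = (fine (\int[mu]_x (u x)%:E) / U)%:E)%E.
  under eq_integral do rewrite /F1 mulrC EFinM.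
  rewrite ge0_integralZl//; last 2 first.
  - by move=> x _; rewrite lee_fin.
  - by rewrite lee_fin invr_ge0 ltW.
  by rewrite -(fineK Xfin) -EFinM mulrC.
have E2 : (\int[mu]_x F2 x = (c^-1)%:E)%E.
  under eq_integral do rewrite /F2 mulrC EFinM.
  rewrite ge0_integralZl//; last 2 first.
  - by move=> x _; rewrite lee_fin gauss_pdf_ge0.
  - by rewrite lee_fin invr_ge0 ltW.
  by rewrite iphi mule1.
have E3 : (\int[mu]_x F3 x = \int[mu]_x w x * K^-1%:E)%E.
  by rewrite ge0_integralZr// lee_fin invr_ge0 ltW.
move: main; rewrite {}E1 {}E2 {}E3 -!EFinM -EFinD => main.
rewrite -[leRHS]mule1 -[1%E](_ : K^-1%:E * K%:E = 1)%E; last first.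
  by rewrite -EFinM mulVf// gt_eqF.
rewrite muleA; apply: (le_trans _ (lee_wpmul2r _ main)); last by rewrite lee_fin ltW.
rewrite -(fineK Xfin) poweR_EFin -EFinM lee_fin; set X := fine _.
have X_ge0 : 0 <= X by rewrite fine_ge0.
have amgm : (X / U) `^ s * c^-1 `^ (1 - s) <= s * (X / U) + (1 - s) * c^-1.
  by apply: powR_weighted_amgm; rewrite ?divr_ge0 ?invr_ge0 ?(ltW U0) ?(ltW c0).
apply: (@le_trans _ _ ((X / U) `^ s * c^-1 `^ (1 - s) * K)); last by rewrite ler_pM2r.
rewrite /K mulrACA -!powRM ?divr_ge0 ?invr_ge0 ?(ltW U0) ?(ltW c0)//.
by rewrite divfK ?gt_eqF// mulVf ?gt_eqF// powR1 mulr1.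
Qed.

End prekopa_leindler_line.

Section gaussian_prekopa.
Context (R : realType) (lambda : R).
Local Notation mR := (measurableTypeR R).
Hypothesis lambda0 : 0 < lambda.

Lemma Q_R_ge (g : R -> \bar R) (z u : R) :
  (g u * (expR (- ((z - u) ^+ 2 / (2 * lambda))))%:E <= Q_R lambda g z)%E.
Proof.
rewrite leNgt; apply/negP => H.
have : (Q_R lambda g z < Q_R lambda g z)%E by apply/(Q_R_gt lambda0); exists u.
by rewrite ltxx.
Qed.

Let truncate (g : R -> \bar R) (k : nat) (x : R) : R := fine (mine (g x) k%:R%:E).

Let truncateE g k x : (0 <= g x)%E ->
  ((truncate g k x)%:E = mine (g x) k%:R%:E)%E.
Proof.
move=> g0; rewrite fineK// ge0_fin_numE; last by rewrite le_min g0 lee_fin ler0n.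
by rewrite gt_min ltry orbT.
Qed.

Let truncate_power_cvg (g : R -> \bar R) (p x : R) : 1 <= p -> (0 <= g x)%E ->
  (truncate g k x `^ p)%:E @[k --> \oo] --> (g x `^ p)%E.
Proof.
move=> p1 g0; case gx : (g x) => [y||]; last by rewrite gx in g0.
- apply: cvg_near_cst; near=> k; rewrite poweR_EFin; congr ((_ `^ _)%:E).
  apply: EFin_inj; rewrite truncateE// gx -EFin_min; congr (_%:E).
  apply/min_idPl; near: k; exact: nbhs_infty_ger.
- rewrite poweRyr ?gt_eqF ?(lt_le_trans _ p1)//; apply/cvgeyPge => A; near=> k.
  have -> : truncate g k x = k%:R.
    by apply: EFin_inj; rewrite truncateE// gx min_r ?leey.
  have k1 : 1 <= k%:R :> R by near: k; exact: nbhs_infty_ger.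
  rewrite lee_fin; apply: (@le_trans _ _ (k%:R : R)).
    near: k; exact: nbhs_infty_ger.
  by rewrite -[leLHS]powRr1 ?ler0n// ler_powR.
Unshelve. all: by end_near. Qed.

(** g may be unbounded or infinite. The bounded case applied to min (g, k) gives a bound independent
    of k, and monotone convergence removes the truncation. *)
Lemma gaussian_prekopa (g : R -> \bar R) :
  measurable_fun [set: mR] g -> (forall x, 0 <= g x)%E ->
  measurable_fun [set: mR] (Q_R lambda g) ->
  ((\int[gamma R]_x (g x `^ (1 + lambda))) `^ (1 + lambda)^-1 <=
   \int[gamma R]_z Q_R lambda g z)%E.
Proof.
move=> mg g0 mQ; set p := 1 + lambda.
have p0 : 0 < p by exact: addr_gt0.
have p1 : 1 <= p by rewrite lerDl ltW.
have Q0 z : (0 <= Q_R lambda g z)%E by exact: Qop_ge0.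
set B := (\int[gamma R]_z Q_R lambda g z)%E.
have B0 : (0 <= B)%E by apply: integral_ge0 => z _.
have mt k : measurable_fun [set: mR] (truncate g k : mR -> mR).
  by apply: measurableT_comp => //; exact: measurable_mine.
have t0 k x : 0 <= truncate g k x.
  by rewrite fine_ge0// le_min g0 lee_fin ler0n.
have tk k x : truncate g k x <= k%:R.
  by rewrite -lee_fin truncateE// ge_min lexx orbT.
have tg k x : ((truncate g k x)%:E <= g x)%E by rewrite truncateE// ge_min lexx.
have I_le k : (\int[gamma R]_x (truncate g k x `^ p)%:E <= B `^ p)%E.
  have hM x : 0 <= truncate g k x <= k%:R by rewrite t0 tk.
  have hW z u : ((truncate g k u * expR (- ((z - u) ^+ 2 / (2 * lambda))))%:E <=
      Q_R lambda g z)%E.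
    by apply: le_trans (Q_R_ge g z u); rewrite EFinM lee_wpmul2r ?lee_fin ?expR_ge0.
  have := gaussian_prekopa_bounded lambda0 mQ Q0 (mt k) hM hW.
  rewrite -/p -/B => /(gt0_ler_poweR (ltW p0)); rewrite -poweRrM mulVf ?gt_eqF//.
  rewrite poweRe1; last by apply: integral_ge0 => x _; rewrite lee_fin powR_ge0.
  by apply; rewrite in_itv/= ?poweR_ge0 ?B0 ?leey.
have mono c d q : 0 <= q -> (0 <= c)%E -> (c <= d)%E -> (c `^ q <= d `^ q)%E.
  move=> q0 c0 cd; apply: gt0_ler_poweR => //; rewrite in_itv/= leey andbT//.
  exact: le_trans cd.
have mtp k : measurable_fun [set: mR] (fun x => (truncate g k x `^ p)%:E).
  by apply/measurable_EFinP; exact: (measurableT_comp (measurable_powR _) (mt k)).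
have IB : (\int[gamma R]_x (g x `^ p) <= B `^ p)%E.
  under eq_integral => x _ do rewrite -(cvg_lim _ (truncate_power_cvg p1 (g0 x)))//.
  rewrite monotone_convergence//; last 2 first.
  - by move=> k x _; rewrite lee_fin powR_ge0.
  - move=> x _ k l kl; rewrite lee_fin; apply: ge0_ler_powR; rewrite ?nnegrE ?(ltW p0)//.
    rewrite -lee_fin !truncateE// le_min ge_min lexx/= ge_min; apply/orP; right.
    by rewrite lee_fin ler_nat.
  apply: lime_le; last by apply: nearW => k; exact: I_le.
  apply: ereal_nondecreasing_is_cvgn => k l kl; apply: ge0_le_integral => //.
  - by move=> x _; rewrite lee_fin powR_ge0.
  move=> x _; rewrite lee_fin; apply: ge0_ler_powR; rewrite ?nnegrE ?(ltW p0)//.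
  rewrite -lee_fin !truncateE// le_min ge_min lexx/= ge_min; apply/orP; right.
  by rewrite lee_fin ler_nat.
rewrite -[leRHS](poweRe1 B0) -(divff (lt0r_neq0 p0)) poweRrM.
apply: mono => //; first by rewrite invr_ge0 ltW.
by apply: integral_ge0 => x _; exact: poweR_ge0.
Qed.

End gaussian_prekopa.

Theorem corollary6p3 (R : realType) (d : nat) (lambda : R)
    (f : 'rV[R]_d -> R) :
  0 < lambda ->
  measurable_fun setT f ->
  (forall x, 0 <= f x) ->
  [/\ (completed_integral (gaussian R d) (Q_rV lambda (EFin \o f)) >=
       completed_integral (gamma R) (Q_R lambda (rearrangement f)))%E,
      (completed_integral (gamma R) (Q_R lambda (rearrangement f)) >=
       completed_norm (gamma R) (1 + lambda) (rearrangement f))%E &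
      completed_norm (gamma R) (1 + lambda) (rearrangement f) =
      completed_norm (gaussian R d) (1 + lambda) (EFin \o f)].
Proof.
move=> lambda0 mf f0.
have p0 : 0 < 1 + lambda by exact: addr_gt0.
have mr := measurable_rearrangement mf.
have r0 := rearrangement_ge0 f.
have mQr := measurable_Q_rearrangement lambda mf.
have Qr0 := Q_rearrangement_ge0 lambda f.
have mQ := measurable_Q_rV lambda0 f0.
have Q0 y : (0 <= Q_rV lambda (EFin \o f) y)%E by exact: Q_rV_ge0.
have mEf : measurable_fun setT (EFin \o f) by exact/measurable_EFinP.
have Ef0 y : (0 <= (EFin \o f) y)%E by rewrite lee_fin.
rewrite !completed_integralE// !completed_normE//; split.
- exact: integral_Q_rearrangement_le.
- exact: gaussian_prekopa.
- by congr (_ `^ _)%E; exact: integral_rearrangement_power.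
Qed.
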